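(* For every $k\in\mathbb{N}$, the exceptional set $$\mathfrak{E}^{(k)}=\{(\boldsymbol{a},\boldsymbol{b},\lambda)\in A^{(k)}\times\mathbb{R}^k\times(0,1): f_{\boldsymbol{a},\boldsymbol{b},\lambda}\text{ is not asymptotically periodic}\}$$ has zero $2k$-dimensional Lebesgue measure, and its Hausdorff dimension is larger than or equal to $k$.
   Context: $\mathbb{N}=\{1,2,\ldots\}$ and $I=[0,1)$. For $k\in\mathbb{N}$, $A^{(k)}=\{(0,a_1,\ldots,a_{k-1})\in\mathbb{R}^k: 0<a_1<\cdots<a_{k-1}<1\}$, which is identified with a subset of $\mathbb{R}^{k-1}$ by dropping the first coordinate; thus $A^{(k)}\times\mathbb{R}^k\times(0,1)$ is regarded as a subset of $\mathbb{R}^{2k}$. Given $\boldsymbol{a}=(0,a_1,\ldots,a_{k-1})\in A^{(k)}$, $\boldsymbol{b}=(b_1,\ldots,b_k)\in\mathbb{R}^k$ and $0<\lambda<1$, put $a_0=0$, $a_k=1$, let $F:I\to\mathbb{R}$ be given by $F(x)=\lambda x+b_i$ for $x\in[a_{i-1},a_i)$, $1\le i\le k$, and let $f_{\boldsymbol{a},\boldsymbol{b},\lambda}:I\to I$ be $f_{\boldsymbol{a},\boldsymbol{b},\lambda}(x)=F(x)\pmod 1$ (representative in $[0,1)$). For $f:I\to I$ and $x\in I$, $\omega(f,x)$ is the $\omega$-limit set of $f$ at $x$, and $\omega(f)=\bigcup_{x\in I}\omega(f,x)$. The map $f$ is asymptotically periodic if for every $x\in I$ the set $\omega(f,x)$ equals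 a periodic orbit of $f$, and $\omega(f)$ consists of finitely many periodic orbits. *)

(* Defs.v *)
From mathcomp Require Import all_boot all_order all_algebra.
From mathcomp Require Import all_classical all_reals all_analysis.
Import Order.TTheory GRing.Theory Num.Theory.
Import numFieldNormedType.Exports.

Set Implicit Arguments.
Unset Strict Implicit.
Unset Printing Implicit Defensive.

Local Open Scope classical_set_scope.
Local Open Scope ring_scope.

Definition box (R : realType) (n : nat) (l u : 'rV[R]_n) : set 'rV[R]_n :=
  [set x | forall i, l 0 i <= x 0 i <= u 0 i].

Definition box_vol (R : realType) (n : nat) (l u : 'rV[R]_n) : R :=
  \prod_(i < n) (u 0 i - l 0 i).

(* n-dimensional Lebesgue outer measure (for n >= 1), by countable covers with
   possibly degenerate boxes. On Lebesgue measurable sets it is the Lebesgue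
   measure; as the latter is complete, a set is Lebesgue measurable of measure
   zero if and only if its outer measure is 0. *)
Definition lebesgue_outer (R : realType) (n : nat) (A : set 'rV[R]_n) : \bar R :=
  ereal_inf [set (\sum_(j <oo) (box_vol (lu j).1 (lu j).2)%:E)%E
    | lu in [set lu : nat -> 'rV[R]_n * 'rV[R]_n |
        (forall j i, (lu j).1 0 i <= (lu j).2 0 i) /\
        A `<=` \bigcup_j box (lu j).1 (lu j).2]].

(* The norm of 'rV[R]_n in the library is the sup norm, hence this definition. *)
Definition euclidean_dist (R : realType) (n : nat) (x y : 'rV[R]_n) : R :=
  Num.sqrt (\sum_(i < n) (x 0 i - y 0 i) ^+ 2).

(* The element 0 is added so that the empty set has diameter 0, not -oo. *)
Definition diam (R : realType) (n : nat) (U : set 'rV[R]_n) : \bar R :=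
  ereal_sup (0%E |`
    [set (euclidean_dist xy.1 xy.2)%:E | xy in [set xy | U xy.1 /\ U xy.2]]).

(* (diam U)^s, with the conventions 0^0 = 1 for nonempty U and (diam set0)^s = 0
   for every s >= 0. *)
Definition diam_pow (R : realType) (n : nat) (s : R) (U : set 'rV[R]_n) : \bar R :=
  if U == set0 then 0%E else (diam U `^ s)%E.

Definition hausdorff_premeasure (R : realType) (n : nat) (s delta : R)
    (A : set 'rV[R]_n) : \bar R :=
  ereal_inf [set (\sum_(j <oo) diam_pow s (U j))%E
    | U in [set U : nat -> set 'rV[R]_n |
        A `<=` \bigcup_j U j /\ forall j, (diam (U j) <= delta%:E)%E]].

Definition hausdorff_measure (R : realType) (n : nat) (s : R)
    (A : set 'rV[R]_n) : \bar R :=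
  ereal_sup [set hausdorff_premeasure s delta A | delta in [set delta : R | 0 < delta]].

Definition hausdorff_dim (R : realType) (n : nat) (A : set 'rV[R]_n) : \bar R :=
  ereal_inf [set s%:E | s in [set s : R | 0 <= s /\ hausdorff_measure s A = 0%E]].

(* A map f : I -> I, with I = [0,1), is represented by a function f : R -> R, of
   which only the values on I matter. *)

Definition I01 (R : realType) : set R := [set x | 0 <= x < 1].

(* The omega-limit set in the space I: the closure of the tails of the orbit is
   taken relative to I. *)
Definition omega_limit (R : realType) (f : R -> R) (x : R) : set R :=
  @I01 R `&` \bigcap_m closure [set iter n f x | n in [set n | (m <= n)%N]].

Definition omega_set (R : realType) (f : R -> R) : set R :=
  \bigcup_(x in @I01 R) omega_limit f x.

Definition periodic_orbit (R : realType) (f : R -> R) (O : set R) : Prop :=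
  exists p q, [/\ I01 p, (0 < q)%N, iter q f p = p &
                  O = range (fun n => iter n f p)].

Definition asymptotically_periodic (R : realType) (f : R -> R) : Prop :=
  (forall x, I01 x -> periodic_orbit f (omega_limit f x)) /\
  (exists P : set (set R),
     [/\ finite_set P, P `<=` periodic_orbit f & omega_set f = \bigcup_(O in P) O]).

(* For k >= 1, the sequence a_0 = 0, a_1, ..., a_{k-1}, a_k = 1; below, a_{j+1}
   is [a 0 j] and b_{i+1} is [b 0 i]. *)
Definition breakpoints (R : realType) (k : nat) (a : 'rV[R]_k.-1) : seq R :=
  0 :: rcons [seq a 0 j | j <- enum 'I_k.-1] 1.

Definition Aset (R : realType) (k : nat) : set 'rV[R]_k.-1 :=
  [set a | sorted <%R (breakpoints a)].

(* F restricted to I: for a in A^(k) and x in I, exactly one term occurs in the sum. *)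
Definition Fabl (R : realType) (k : nat) (a : 'rV[R]_k.-1) (b : 'rV[R]_k)
    (lambda x : R) : R :=
  \sum_(i < k | (breakpoints a)`_i <= x < (breakpoints a)`_i.+1)
     (lambda * x + b 0 i).

Definition fabl (R : realType) (k : nat) (a : 'rV[R]_k.-1) (b : 'rV[R]_k)
    (lambda x : R) : R :=
  Fabl a b lambda x - (Num.floor (Fabl a b lambda x))%:~R.

Definition exceptional_triples (R : realType) (k : nat) :
    set ('rV[R]_k.-1 * 'rV[R]_k * R) :=
  [set p | [/\ Aset p.1.1, 0 < p.2 < 1 &
               ~ asymptotically_periodic (fabl p.1.1 p.1.2 p.2)]].

(* As a subset of R^{2k}: (k - 1) + k + 1 = 2 k since k >= 1. *)
Definition exceptional_set (R : realType) (k : nat) :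
    set 'rV[R]_(k.-1 + k + 1) :=
  [set row_mx (row_mx p.1.1 p.1.2) (const_mx p.2) | p in @exceptional_triples R k].

(* Main.v *)
(** Measure zero.  Lift [f] to the real line and code orbits by the cells cut out by the
    translates of the breakpoints.  If some iterate of [f] maps [0,1) at a positive
    distance from all breakpoints, then [f] is eventually a local contraction and hence
    asymptotically periodic.  Otherwise, for every [n], some orbit comes within
    [lambda ^ n] of a breakpoint at time [n].  For a fixed itinerary, this puts the
    parameter in a slab of thickness O(lambda ^ n), because moving all [b_i] together
    moves the orbit but not the breakpoints.  Outside the null set of parameters for
    which a one-sided orbit of a breakpoint hits a breakpoint, a cluster of orbits of
    nearby parameters splits at most once in [N] steps, so that there are O(2 ^ (n / N))
    itineraries of length [n], which is too few to compensate [lambda ^ n].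

    Dimension.  When all [b_i] are equal, [f] is a contracted rotation that does not depend
    on the breakpoints.  For every [lambda] some value of [b] gives it the irrational
    rotation number [sqrt 2 - 1], hence no periodic point.  So the exceptional set projects
    onto A^(k) x (0,1), which contains a [k]-dimensional cube. *)

From mathcomp Require Import all_boot all_order all_algebra.
From mathcomp Require Import all_classical all_reals all_analysis.
From mathcomp Require Import ring lra zify.
Require Import Defs.
Import Order.TTheory GRing.Theory Num.Theory.
Import numFieldNormedType.Exports.

Set Implicit Arguments.
Unset Strict Implicit.
Unset Printing Implicit Defensive.

Local Open Scope classical_set_scope.
Local Open Scope ring_scope.

(** The count of itineraries must be uniform in the parameter, so an itinerary belongs to a pair of
    a parameter and a point, and all parameters of a small grid cell are followed together.
    Itineraries are words of lifted cells: along a fixed word the endpoint is an affine function of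
    the starting point and of the intercepts, which makes different parameters comparable. A cluster
    smaller than the gaps is cut by at most one breakpoint at a time. Once it is cut, its pieces
    shadow the two one-sided orbits of that breakpoint, which keep away from all breakpoints for [N]
    steps. To have [N], the distance [eta] and a slope bound [l] uniform, the parameters without
    connections are distributed over countably many sets [wild l N eta], with [2 l ^ N <= 1 / 2] so
    that doubling every [N] steps is outweighed. The slab estimate saves one dimension: cutting the
    2k - 1 coordinates other than the common translation to size [h] fixes the last one up to O(h),
    so a word costs about [h ^ (1 - 2k)] boxes of volume O([h ^ (2k)]), in total O(h). Working with
    explicit box covers throughout avoids every question of measurability. *)

(** * Local contractions are asymptotically periodic *)

Section AsymptoticallyPeriodicCriterion.
Variable R : realType.
Implicit Types (f : R -> R) (Z : set R).

Lemma closure_realP (A : set R) x :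
  closure A x <-> forall e, 0 < e -> exists2 y, A y & `|x - y| < e.
Proof.
split=> [cAx e e0|H B].
  have [y [Ay]] := cAx _ (nbhsx_ballx x e e0).
  by rewrite /ball /= => xy; exists y.
move=> /nbhs_ballP[e /= e0 eB].
by have [y Ay xy] := H e e0; exists y; split=> //; apply: eB.
Qed.

Lemma expr_small (m : R) e : 0 <= m < 1 -> 0 < e -> exists n, m ^+ n < e.
Proof.
move=> /andP[m0 m1] e0.
have := @cvg_expr R m; rewrite ger0_norm // => /(_ m1) /cvgr0Pnorm_lt /(_ e e0).
case=> n _ /(_ n) /= /(_ (leqnn n)) H; exists n.
by apply: le_lt_trans H; rewrite ler_norm.
Qed.

(** With [C = D / (1 - m)], the intervals of radius [C * m ^+ r] around [s r] are nested; the limit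
    is the supremum of their left ends. *)
Lemma geometric_limit (s : nat -> R) (D m : R) : 0 <= m < 1 -> 0 <= D ->
  (forall r, `|s r.+1 - s r| <= D * m ^+ r) ->
  exists p, forall r, `|s r - p| <= D / (1 - m) * m ^+ r.
Proof.
move=> /andP[m0 m1] D0 H; set C := D / (1 - m).
have CD : C - C * m = D by rewrite /C; field; lra.
have C0 : 0 <= C by rewrite divr_ge0 // subr_ge0 ltW.
pose a r := s r - C * m ^+ r; pose b r := s r + C * m ^+ r.
have stepE r : C * m ^+ r - C * m ^+ r.+1 = D * m ^+ r.
  by rewrite exprS -CD; ring.
have ainc r t : a r <= a (r + t)%N.
  elim: t => [|t IH]; rewrite ?addn0 // addnS; apply: le_trans IH _.
  move: (H (r + t)%N) (stepE (r + t)%N); rewrite /a ler_norml => /andP[]; lra.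
have bdec r t : b (r + t)%N <= b r.
  elim: t => [|t IH]; rewrite ?addn0 // addnS; apply: le_trans IH.
  move: (H (r + t)%N) (stepE (r + t)%N); rewrite /b ler_norml => /andP[]; lra.
have ab r : a r <= b r.
  have : 0 <= C * m ^+ r by rewrite mulr_ge0 ?exprn_ge0.
  rewrite /a /b; lra.
have atb t r : a t <= b r.
  apply: le_trans (ainc t r) _; apply: le_trans (ab _) _.
  by rewrite addnC; apply: bdec.
have hs : has_sup (range a).
  by split; [exists (a 0%N), 0%N | exists (b 0%N) => _ [t _ <-]].
exists (sup (range a)) => r.
have ap : a r <= sup (range a) by apply: ub_le_sup (proj2 hs) _ _; exists r.
have pb : sup (range a) <= b r.
  by apply: ge_sup (proj1 hs) _ => _ [t _ <-].
move: ap pb; rewrite /a /b ler_norml => *; lra.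
Qed.

(** Pigeonhole: cut the unit interval into [M > 1 / e] equal pieces and look at [M + 1] terms. *)
Lemma close_pair (z : nat -> R) e : 0 < e -> (forall n, 0 <= z n < 1) ->
  exists i q, (0 < q)%N /\ `|z i - z (i + q)%N| < e.
Proof.
move=> e0 z01; set M := (Num.trunc e^-1).+1.
have Me : 1 < M%:R * e.
  by rewrite -ltr_pdivrMr // div1r truncnS_gt.
have zM0 n : 0 <= z n * M%:R by case/andP: (z01 n) => *; rewrite mulr_ge0.
have bd n : (Num.trunc (z n * M%:R) < M)%N.
  rewrite truncn_lt_nat //; case/andP: (z01 n) => _ z1.
  by rewrite gtr_pMl // ltr0n.
pose g (n : 'I_M.+1) : 'I_M := Ordinal (bd n).
have : ~~ injectiveb g.
  by apply/injectiveP => /leq_card; rewrite !card_ord ltnn.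
case/injectivePn => i [j ij gij].
have cl (i1 j1 : 'I_M.+1) : g i1 = g j1 -> `|z i1 - z j1| < e.
  move=> /(congr1 val) /= tE.
  have := truncn_itv (zM0 i1); have := truncn_itv (zM0 j1); rewrite tE -natr1.
  move=> /andP[h1 h2] /andP[h3 h4].
  have M0 : 0 < M%:R :> R by rewrite ltr0n.
  rewrite -(ltr_pM2r M0) -[X in _ * X < _](gtr0_norm M0) -normrM mulrBl ltr_norml.
  apply/andP; split; lra.
case: (ltngtP i j) => [lij|lij|/val_inj/eqP]; last by rewrite (negPf ij).
  exists i, (j - i)%N; rewrite subn_gt0 lij subnKC ?(ltnW lij) //; split=> //.
  exact: cl.
exists j, (i - j)%N; rewrite subn_gt0 lij subnKC ?(ltnW lij) //; split=> //.
exact: cl.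
Qed.

Lemma separated_finite (A : set R) e : 0 < e -> A `<=` @I01 R ->
  (forall x y, A x -> A y -> `|x - y| < e -> x = y) -> finite_set A.
Proof.
move=> e0 AI sep; apply: contrapT => /infiniteP /pcard_leP [g].
have gA n : A (g n) by apply: funS.
have [|i [q [q0 d]]] := @close_pair g e e0.
  by move=> n; have := AI _ (gA n).
have /(inj (in_setT _) (in_setT _)) := sep _ _ (gA i) (gA (i + q)%N) d.
by lia.
Qed.

Section Contracting.
Variables (f : R -> R) (Z : set R) (l e : R) (n0 : nat).
Hypotheses (l01 : 0 <= l < 1) (e0 : 0 < e) (ZI : Z `<=` @I01 R)
  (Zcl : closed Z) (fZ : forall z, Z z -> Z (f z))
  (fl : forall z z', Z z -> Z z' -> `|z - z'| < e -> `|f z - f z'| <= l * `|z - z'|)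
  (absorb : forall x, I01 x -> Z (iter n0 f x)).

Lemma iter_stable z n : Z z -> Z (iter n f z).
Proof. by move=> Zz; elim: n => //= n; apply: fZ. Qed.

Lemma iter_contract z z' n : Z z -> Z z' -> `|z - z'| < e ->
  `|iter n f z - iter n f z'| <= l ^+ n * `|z - z'|.
Proof.
move=> Zz Zz' d; case/andP: l01 => l0 l1; elim: n => [|n IH]; first by rewrite expr0 mul1r.
rewrite !iterS exprS -mulrA.
have dn : `|iter n f z - iter n f z'| < e.
  apply: le_lt_trans IH _; apply: le_lt_trans d.
  by rewrite ler_piMl // exprn_ile1 // ltW.
apply: le_trans (fl _ _ dn) _; try exact: iter_stable.
exact: ler_wpM2l.
Qed.

Lemma iter_fixM q p r : iter q f p = p -> iter (r * q) f p = p.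
Proof. by move=> H; elim: r => //= r IH; rewrite mulSn iterD IH. Qed.

(** By pigeonhole the orbit returns [e]-close to itself after some [q] steps. From then on
    contraction makes consecutive terms of the times [i + r * q] approach each other geometrically;
    their limit [p] is [q]-periodic because [iter q f] contracts near [p], and the intermediate
    times follow by applying [iter n f]. *)
Lemma attracted x : I01 x -> exists i q p, [/\ (0 < q)%N, Z p, iter q f p = p &
  forall d, 0 < d -> exists r0, forall r n, (r0 <= r)%N ->
    `|iter (i + r * q + n) f x - iter n f p| < d].
Proof.
move=> x01; case/andP: (l01) => l0 l1.
pose z n := iter (n + n0) f x.
have zZ n : Z (z n) by rewrite /z iterD; apply: iter_stable; apply: absorb.
have [|i [q [q0 dz]]] := @close_pair z e e0; first by move=> n; have := ZI (zZ n).
pose s r := z (i + r * q)%N.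
have zD n m : z (n + m)%N = iter m f (z n) by rewrite /z -iterD; congr iter; lia.
have q1 : l ^+ q < 1 by rewrite exprn_ilt1 // -lt0n.
have q0' : 0 <= l ^+ q by rewrite exprn_ge0.
have sstep r : `|s r.+1 - s r| <= e * (l ^+ q) ^+ r.
  have -> : s r.+1 = iter (r * q) f (z (i + q)%N).
    by rewrite -zD /s mulSn addnA.
  rewrite /s [z (i + r * q)%N]zD -exprM distrC.
  apply: le_trans (iter_contract (r * q) (zZ _) (zZ _) dz) _.
  by rewrite mulrC mulnC ler_wpM2r ?exprn_ge0 // ltW.
have [|p Hp] := geometric_limit _ (ltW e0) sstep; first by rewrite q0'.
set C := e / (1 - l ^+ q) in Hp.
have C0 : 0 <= C by rewrite divr_ge0 ?(ltW e0) // subr_ge0 ltW.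
have small d : 0 < d -> exists r0, forall r, (r0 <= r)%N -> `|s r - p| < d.
  move=> d0; have [||r0 Hr0] := @expr_small (l ^+ q) (d / (C + 1)).
  - by rewrite q0'.
  - by rewrite divr_gt0 //; lra.
  exists r0 => r r0r; apply: le_lt_trans (Hp r) _.
  have : (l ^+ q) ^+ r <= (l ^+ q) ^+ r0 by apply: ler_wiXn2l => //; apply: ltW.
  move: Hr0; rewrite ltr_pdivlMr; last lra.
  have := exprn_ge0 r q0'; nra.
have Zp : Z p.
  rewrite (closure_id Z).1 //; apply/closure_realP => d /small[r0 H].
  by exists (s r0); [exact: zZ | rewrite distrC; apply: H].
have fp : iter q f p = p.
  apply/eqP; rewrite -subr_eq0 -normr_le0; apply/ler_addgt0Pr => d d0; rewrite add0r.
  have [|r0 H] := @small (Num.min e (d / 2)).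
    by rewrite lt_min e0 divr_gt0.
  have /= := H r0.+1 (leqnSn _); have := H r0 (leqnn _).
  rewrite !lt_min => /andP[h1 h2] /andP[h3 h4].
  have := iter_contract q (zZ _ : Z (s r0)) Zp h1.
  have -> : iter q f (s r0) = s r0.+1 by rewrite /s -(zD (i + r0 * q)%N q) mulSnr addnA.
  move=> h5; have h6 : l ^+ q * `|s r0 - p| <= `|s r0 - p| by rewrite ler_piMl // ltW.
  have := ler_distD (s r0.+1) (iter q f p) p; rewrite (distrC (iter q f p) (s _)); lra.
exists (i + n0)%N, q, p; split=> // d d0.
have [|r0 H] := @small (Num.min e d); first by rewrite lt_min e0.
exists r0 => r n r0r; have := H r r0r; rewrite lt_min => /andP[h1 h2].
have -> : iter (i + n0 + r * q + n) f x = iter n f (s r).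
  by rewrite /s /z -iterD; congr iter; lia.
apply: le_lt_trans (iter_contract n (zZ _) Zp h1) _; apply: le_lt_trans h2.
by rewrite ler_piMl // exprn_ile1 // ltW.
Qed.

Lemma omega_limit_orbit x : I01 x ->
  exists q p, [/\ (0 < q)%N, Z p, iter q f p = p &
    omega_limit f x = range (fun n => iter n f p)].
Proof.
move=> x01; have [i [q [p [q0 Zp fp H]]]] := attracted x01.
exists q, p; split=> //; apply/seteqP; split=> y; last first.
  move=> [n _ <-]; split; first by apply/ZI/iter_stable.
  move=> m _; apply/closure_realP => d /H[r0 Hr].
  exists (iter (i + (r0 + m) * q + n) f x); last by rewrite distrC; apply: Hr; lia.
  exists (i + (r0 + m) * q + n)%N => //=; nia.
move=> [y01 cy]; apply: contrapT => ny.
have per n : iter n f p = iter (n %% q) f p.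
  by rewrite {1}(divn_eq n q) addnC iterD iter_fixM.
have [d d0 dy] : exists2 d, 0 < d & forall n, d <= `|y - iter n f p|.
  have : forall M, exists2 d, 0 < d & forall n, (n < M)%N -> d <= `|y - iter n f p|.
    elim=> [|M [d d0 IH]]; first by exists 1.
    exists (Num.min d `|y - iter M f p|).
      rewrite lt_min d0 normr_gt0 subr_eq0 /=; apply/eqP => yE.
      by apply: ny; exists M.
    move=> n; rewrite ltnS leq_eqVlt ge_min => /orP[/eqP ->|/IH ->//].
    by rewrite lexx orbT.
  move=> /(_ q) [d d0 H']; exists d => // n; rewrite per; apply: H'.
  by rewrite ltn_mod.
have d20 : 0 < d / 2 by rewrite divr_gt0.
have [r0 Hr] := H _ d20.
have /closure_realP /(_ _ d20) [_ [N /= HN <-] h] := cy (i + r0 * q)%N I.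
have := Hr r0 (N - (i + r0 * q))%N (leqnn _); rewrite subnKC //.
have := dy (N - (i + r0 * q))%N.
have := ler_distD (iter N f x) y (iter (N - (i + r0 * q))%N f p); lra.
Qed.

(** After the common period [q * q'] both points are back, yet their distance has shrunk by a factor
    below 1. *)
Lemma periodic_close_eq p p' q q' : (0 < q)%N -> (0 < q')%N -> Z p -> Z p' ->
  iter q f p = p -> iter q' f p' = p' -> `|p - p'| < e -> p = p'.
Proof.
move=> q0 q'0 Zp Zp' fp fp' d; case/andP: (l01) => l0 l1.
have : `|iter (q * q') f p - iter (q * q') f p'| <= l ^+ (q * q') * `|p - p'|.
  exact: iter_contract.
rewrite (iter_fixM q fp') mulnC (iter_fixM q' fp) => h.
have l2 : l ^+ (q' * q) < 1 by rewrite exprn_ilt1 // -lt0n muln_gt0 q0 q'0.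
apply/eqP; rewrite -subr_eq0 -normr_le0; have := normr_ge0 (p - p'); nra.
Qed.

(** Only finitely many orbits occur, since distinct periodic points of [Z] are at distance at least
    [e]. *)
Lemma contracting_asymptotically_periodic : asymptotically_periodic f.
Proof.
split=> [x x01|].
  have [q [p [q0 Zp fp oE]]] := omega_limit_orbit x01.
  by exists p, q; split=> //; apply: ZI.
pose Per := [set p | Z p /\ exists q, (0 < q)%N /\ iter q f p = p].
have finPer : finite_set Per.
  apply: (@separated_finite Per e e0) => [p [/ZI//]|p p' [Zp [q [q0 fp]]] [Zp' [q' [q'0 fp']]]].
  exact: (periodic_close_eq q0 q'0).
exists [set omega_limit f x | x in @I01 R]; split.
- apply: (@sub_finite_set _ _ [set range (fun n => iter n f p) | p in Per]).
    move=> _ [x x01 <-]; have [q [p [q0 Zp fp oE]]] := omega_limit_orbit x01.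
    by exists p => //; split=> //; exists q.
  exact: finite_image.
- move=> _ [x x01 <-]; have [q [p [q0 Zp fp oE]]] := omega_limit_orbit x01.
  by exists p, q; split=> //; apply: ZI.
- by rewrite /omega_set bigcup_image.
Qed.

End Contracting.
End AsymptoticallyPeriodicCriterion.

(** * Words followed by an orbit *)

Section Itineraries.
Variables (R : realType) (bet : int -> R) (G : int -> R -> R).

Fixpoint tracks (u : R) (w : seq int) : bool :=
  if w is c :: w' then (bet c <= u < bet (c + 1)) && tracks (G c u) w' else true.

(** Closed cells admit the left-hand orbit of a breakpoint, which starts at the right end of its
    cell and uses the branch of that cell. *)
Fixpoint ctracks (u : R) (w : seq int) : bool :=
  if w is c :: w' then (bet c <= u <= bet (c + 1)) && ctracks (G c u) w' else true.

Fixpoint endpoint (u : R) (w : seq int) : R :=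
  if w is c :: w' then endpoint (G c u) w' else u.

(** The robust form of [tracks]: a small change of the point or of the system leaves the word
    unchanged. *)
Fixpoint far (eta u : R) (w : seq int) : bool :=
  if w is c :: w' then (bet c + eta <= u <= bet (c + 1) - eta) && far eta (G c u) w'
  else true.

Lemma tracks_cat u w w' :
  tracks u (w ++ w') = tracks u w && tracks (endpoint u w) w'.
Proof. by elim: w u => //= c w IH u; rewrite IH andbA. Qed.

Lemma tracks_ctracks u w : tracks u w -> ctracks u w.
Proof.
elim: w u => //= c w IH u /andP[/andP[h1 h2] /IH ->].
by rewrite h1 (ltW h2).
Qed.

Hypothesis (bet_cell : forall u, exists c, bet c <= u < bet (c + 1)).

Lemma exists_tracks u n : exists2 w, size w = n & tracks u w.
Proof.
elim: n u => [|n IH] u; first by exists [::].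
have [c hc] := bet_cell u; have [w sw tw] := IH (G c u).
by exists (c :: w) => /=; rewrite ?sw ?hc.
Qed.

End Itineraries.

(** * Counting the itineraries of a cluster *)

Section FewItineraries.
Variables (R : realType) (S : Type) (bet : S -> int -> R) (G : S -> int -> R -> R).
Variables (Q : set S) (l r e eta : R) (N : nat).
(** Two systems of [Q] differ by at most [r]. The inequality [l * e + r <= e] keeps the diameter of
    a cluster below [e] as long as it shares its letters, and [5 * e] leaves room for a shadowing
    error [3 * e] plus the displacement [r <= e] of a breakpoint. *)
Hypotheses (l01 : 0 <= l < 1) (r0 : 0 <= r) (e0 : 0 < e)
  (lre : l * e + r <= e) (eta_big : 5 * e <= eta).
Hypotheses
  (cell : forall s u, Q s -> exists c, bet s c <= u < bet s (c + 1))
  (gap : forall s c, Q s -> bet s c + eta <= bet s (c + 1))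
  (near_bet : forall s s' c, Q s -> Q s' -> `|bet s c - bet s' c| <= r)
  (near_G : forall s s' c u u', Q s -> Q s' ->
     bet s c <= u <= bet s (c + 1) -> bet s' c <= u' <= bet s' (c + 1) ->
     `|G s c u - G s' c u'| <= l * `|u - u'| + r)
  (far_right : forall s c, Q s -> exists2 w, size w = N &
     far (bet s) (G s) eta (G s c (bet s c)) w)
  (far_left : forall s c, Q s -> exists2 w, size w = N &
     far (bet s) (G s) eta (G s c (bet s (c + 1))) w).

Lemma small_r : r <= e.
Proof. by have := l01 => /andP[h1 h2]; move: lre r0 e0; nra. Qed.

Lemma bet_homo s c d : Q s -> c <= d -> bet s c <= bet s d.
Proof.
move=> Qs cd; have -> : d = c + `|d - c|%N%:Z by lia.
elim: `|d - c|%N => [|m IH]; first by rewrite addr0.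
apply: le_trans IH _.
have := gap (c + m%:Z) Qs; rewrite -addrA; have -> : m%:Z + 1 = m.+1%:Z by lia.
move: eta_big e0; lra.
Qed.

Lemma bet_lt_le s c d : Q s -> bet s c < bet s (d + 1) -> c <= d.
Proof.
move=> Qs h; rewrite leNgt; apply/negP => dc.
have : bet s (d + 1) <= bet s c by apply: bet_homo; rewrite ?lezD1.
by move=> /(lt_le_trans h); rewrite ltxx.
Qed.

Lemma near_pair s s' c : Q s -> Q s' -> bet s c <= bet s' c + r /\ bet s' c <= bet s c + r.
Proof.
by move=> Qs Qs'; have := near_bet c Qs Qs'; rewrite ler_norml => /andP[]; split; lra.
Qed.

(** The error [3 * e] reproduces itself, as [l * (3 * e) + r <= 3 * e], and is too small to push [u]
    across a breakpoint from which [v] stays [eta] away. *)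
Lemma shadow s0 s v u w0 w : Q s0 -> Q s -> `|u - v| <= 3 * e ->
  far (bet s0) (G s0) eta v w0 -> tracks (bet s) (G s) u w ->
  (size w <= size w0)%N -> w = take (size w) w0.
Proof.
move=> Q0 Qs; elim: w0 v u w => [|c w0 IH] v u [|d w] //= d3 /andP[fc fw] /andP[td tw] sz.
case/andP: fc => f1 f2; case/andP: td => t1 t2.
have [b1 b2] := near_pair c Q0 Qs; have [b3 b4] := near_pair (c + 1) Q0 Qs.
move: (d3); rewrite ler_norml => /andP[d1 d2].
have rr := small_r; have e1 := e0; have eb := eta_big.
have cd : d = c.
  apply/eqP; rewrite eq_le; apply/andP; split; apply: (bet_lt_le Qs).
  - by apply: le_lt_trans t1 _; lra.
  - by apply: le_lt_trans t2; lra.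
rewrite cd in t1 t2 tw *; congr cons; apply: IH fw tw sz.
apply: le_trans (near_G Qs Q0 _ _) _; try by apply/andP; split; lra.
case/andP: l01 => l0 l1.
have : l * `|u - v| <= l * (3 * e) by apply: ler_wpM2l.
move: lre r0; lra.
Qed.

(** The cluster shares its letters up to the first split. At the split every point is next to the
    same breakpoint, so its remaining word is that of the right or of the left orbit of this
    breakpoint, and no further split can occur in the remaining steps. *)
Lemma two_words n (C : set (S * R)) : (n <= N)%N -> (forall p, C p -> Q p.1) ->
  (forall p q, C p -> C q -> `|p.2 - q.2| <= e) ->
  exists w1 w2, forall p w, C p -> size w = n -> tracks (bet p.1) (G p.1) p.2 w ->
    w = w1 \/ w = w2.
Proof.
have rr := small_r; case/andP: (l01) => l0 l1; have e1 := e0; have eb := eta_big.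
elim: n C => [|n IH] C nN CQ Ce.
  by exists [::], [::] => p w _ /size0nil ->; left.
have cell_eq s u c d : Q s -> bet s c <= u < bet s (c + 1) ->
    bet s d <= u < bet s (d + 1) -> d = c.
  move=> Qs /andP[u1 u2] /andP[t1 t2].
  apply/eqP; rewrite eq_le; apply/andP; split; apply: (bet_lt_le Qs).
    exact: le_lt_trans u2.
  exact: le_lt_trans t2.
have [[s0 [u0 [c0 [s1 [u1 [c1 [C0 [C1 [h0 [h1 c01]]]]]]]]]]|nosplit] := pselect
  (exists s0 u0 c0 s1 u1 c1, C (s0, u0) /\ C (s1, u1) /\
     bet s0 c0 <= u0 < bet s0 (c0 + 1) /\ bet s1 c1 <= u1 < bet s1 (c1 + 1) /\ c0 < c1).
  have [/= Q0 Q1] := (CQ _ C0, CQ _ C1).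
  have [wr swr fr] := far_right (c0 + 1) Q0; have [wl swl fl] := far_left c0 Q0.
  exists ((c0 + 1) :: take n wr), (c0 :: take n wl) => -[s u] [|c w] //= Cp [sw] /andP[tc tw].
  have /= Qs := CQ _ Cp.
  have [b1 b2] := near_pair (c0 + 1) Q0 Q1.
  have b3 : bet s1 (c0 + 1) <= bet s1 c1 by apply: bet_homo; rewrite ?lezD1.
  have := Ce _ _ C0 Cp; have := Ce _ _ C1 Cp; rewrite /= !ler_norml.
  move=> /andP[d1 d2] /andP[d3 d4].
  case/andP: h0 => h01 h02; case/andP: h1 => h11 h12.
  (* The breakpoint [c0 + 1] lies between [u0] and [u1] up to its displacement [r <= e], and [u] is
     within [e] of both. *)
  have ub : `|u - bet s0 (c0 + 1)| <= 2 * e by rewrite ler_norml; apply/andP; split; lra.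
  move: (ub); rewrite ler_norml => /andP[ub1 ub2].
  case/andP: (tc) => t1 t2.
  have g1 := gap c0 Q0; have g2 := gap (c0 + 1) Q0.
  have near3 d x : bet s0 d <= x <= bet s0 (d + 1) -> `|u - x| <= 2 * e -> d = c ->
      `|G s c u - G s0 c x| <= 3 * e.
    move=> hx ux dc; rewrite dc in hx.
    have tc' : bet s c <= u <= bet s (c + 1) by rewrite t1 ltW.
    apply: le_trans (near_G Qs Q0 tc' hx) _.
    have : l * `|u - x| <= l * (2 * e) by apply: ler_wpM2l.
    move: lre r0; lra.
  have : c = c0 + 1 \/ c = c0.
    have c1' : c <= c0 + 1.
      apply: (bet_lt_le Q0); have [b4 b5] := near_pair c Q0 Qs.
      by apply: le_lt_trans b4 _; lra.
    have c2' : c0 <= c.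
      apply: (bet_lt_le Qs); have [b4 b5] := near_pair c0 Q0 Qs.
      by apply: le_lt_trans t2; lra.
    by move: c1' c2'; clear; lia.
  move=> [cE|cE]; [left|right]; rewrite -sw cE; congr cons.
  - apply: (shadow Q0 Qs _ fr tw); last by rewrite swr sw ltnW.
    rewrite -cE; apply: near3 (erefl c); rewrite cE //.
    by rewrite lexx /=; lra.
  - apply: (shadow Q0 Qs _ fl tw); last by rewrite swl sw ltnW.
    rewrite -cE; apply: near3 (erefl c); rewrite cE //.
    by rewrite lexx andbT; lra.
have [[[s0 u0] C0]|noC] := pselect (exists p, C p); last first.
  by exists [::], [::] => p w Cp; exfalso; apply: noC; exists p.
have /= Q0 := CQ _ C0.
(* Without a split the whole cluster lies in the cell [c], and its image is again a cluster of
   diameter at most [e]. *)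
have [c hc] := cell u0 Q0.
have Hc s u : C (s, u) -> bet s c <= u < bet s (c + 1).
  move=> Cp; have [d hd] := cell u (CQ _ Cp).
  case: (ltgtP c d) => [cd|dc|->//]; exfalso; apply: nosplit.
    by exists s0, u0, c, s, u, d.
  by exists s, u, d, s0, u0, c.
have [|| w1 [w2 H]] := IH [set p | exists u, C (p.1, u) /\ p.2 = G p.1 c u] (ltnW nN).
- by move=> p [u [/CQ]].
- move=> [s x] [s' y] /= [u [Cu ->]] [v [Cv ->]].
  case/andP: (Hc _ _ Cu) => u1 u2; case/andP: (Hc _ _ Cv) => v1 v2.
  have h : `|G s c u - G s' c v| <= l * `|u - v| + r.
    apply: near_G; [exact: (CQ _ Cu)|exact: (CQ _ Cv)| |]; apply/andP; split=> //; exact: ltW.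
  apply: le_trans h _.
  have : l * `|u - v| <= l * e by apply: ler_wpM2l => //; exact: (Ce _ _ Cu Cv).
  move: lre; lra.
exists (c :: w1), (c :: w2) => -[s u] [|d w] //= Cp [sw] /andP[td tw].
have dc := cell_eq _ _ _ _ (CQ _ Cp) (Hc _ _ Cp) td.
rewrite dc in tw *.
have [|->|->] := H (s, G s c u) w _ sw tw; [by exists u|by left|by right].
Qed.

Lemma near_endpoint s s' u u' w : Q s -> Q s' -> `|u - u'| <= e ->
  tracks (bet s) (G s) u w -> tracks (bet s') (G s') u' w ->
  `|endpoint (G s) u w - endpoint (G s') u' w| <= e.
Proof.
move=> Qs Qs'; elim: w u u' => //= c w IH u u' d /andP[/andP[u1 u2] tw] /andP[/andP[v1 v2] tw'].
apply: IH => //; case/andP: l01 => l0 l1.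
have h : `|G s c u - G s' c u'| <= l * `|u - u'| + r.
  by apply: near_G => //; apply/andP; split=> //; exact: ltW.
apply: le_trans h _.
have : l * `|u - u'| <= l * e by apply: ler_wpM2l.
move: lre; lra.
Qed.

(* A cluster splits at most once every [N] steps, hence at most [2 ^ m] itineraries of length [m N]. *)
Lemma few_words m (C : set (S * R)) : (forall p, C p -> Q p.1) ->
  (forall p q, C p -> C q -> `|p.2 - q.2| <= e) ->
  exists L : seq (seq int), (size L <= 2 ^ m)%N /\
    forall p w, C p -> size w = (m * N)%N -> tracks (bet p.1) (G p.1) p.2 w -> w \in L.
Proof.
elim: m C => [|m IH] C CQ Ce.
  by exists [:: [::]]; split=> // p w _ /size0nil ->.
have [w1 [w2 H12]] := two_words (leqnn N) CQ Ce.
(* The part of the cluster that follows [w], transported to the end of [w]; [near_endpoint] makes it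
   a cluster for the induction. *)
pose D w := [set p | exists u, [/\ C (p.1, u), tracks (bet p.1) (G p.1) u w
   & p.2 = endpoint (G p.1) u w]].
have DL w : exists L : seq (seq int), (size L <= 2 ^ m)%N /\
    forall p w', D w p -> size w' = (m * N)%N -> tracks (bet p.1) (G p.1) p.2 w' -> w' \in L.
  apply: IH; first by move=> p [u [/CQ]].
  move=> [s x] [s' y] [u /= [Cu tu ->]] [v /= [Cv tv ->]].
  by apply: near_endpoint => //; [apply: (CQ _ Cu)|apply: (CQ _ Cv)|apply: (Ce _ _ Cu Cv)].
have [L1 [s1 H1]] := DL w1; have [L2 [s2 H2]] := DL w2.
exists (map (cat w1) L1 ++ map (cat w2) L2); split.
  by rewrite size_cat !size_map expnS mul2n -addnn leq_add.
move=> [s u] w Cp sw; rewrite -(cat_take_drop N w) tracks_cat => /andP[/= t1 t2].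
have s_t : size (take N w) = N by rewrite size_take_min sw mulSn; lia.
have s_d : size (drop N w) = (m * N)%N by rewrite size_drop sw mulSn addKn.
rewrite mem_cat; apply/orP.
have [E|E] := H12 (s, u) _ Cp s_t t1; rewrite E in t1 t2 *; [left|right];
  rewrite mem_map; try by move=> x y /eqP; rewrite eqseq_cat // => /andP[_ /eqP].
  by apply: (H1 (s, endpoint (G s) u w1)) => //; exists u.
by apply: (H2 (s, endpoint (G s) u w2)) => //; exists u.
Qed.

End FewItineraries.

(** * The lift to the real line *)

Section LiftedDynamics.
Variables (R : realType) (k : nat).
Local Notation K := k.+1.
Implicit Types (a : 'rV[R]_k) (b : 'rV[R]_K) (la h u : R) (c : int).

Definition al a (i : nat) : R := (@breakpoints R K a)`_i.

Definition md c : nat := `|(c %% K)%Z|%N.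
Definition dv c : R := (c %/ K)%Z%:~R.

(* The real line is cut into the cells [bet c, bet (c + 1)): the cell [c = q K + i]
   is the translate by [q] of the interval between the breakpoints [a_i] and [a_(i+1)].
   The map [gm] on the cell [c] is a lift of [fabl]. *)
Definition bet a c : R := al a (md c) + dv c.
Definition gm b la c u : R := la * (u - dv c) + b 0 (inord (md c)).

Lemma size_breakpoints a : size (@breakpoints R K a) = K.+1.
Proof. by rewrite /= size_rcons size_map size_enum_ord. Qed.

Lemma al0 a : al a 0 = 0. Proof. by []. Qed.

Lemma alK a : al a K = 1.
Proof.
by rewrite /al /breakpoints /= nth_rcons size_map size_enum_ord ltnn eqxx.
Qed.

Lemma alS a (j : 'I_k) : al a j.+1 = a 0 j.
Proof.
rewrite /al /breakpoints /= nth_rcons size_map size_enum_ord ltn_ord.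
rewrite (nth_map j); last by rewrite size_enum_ord ltn_ord.
by rewrite nth_ord_enum.
Qed.

Lemma al_case a i : (i <= K)%N -> [\/ i = 0%N, i = K | exists j : 'I_k, i = j.+1].
Proof.
case: i => [|i]; first by constructor 1.
rewrite ltnS leq_eqVlt => /orP[/eqP->|ik]; first by constructor 2.
by constructor 3; exists (Ordinal ik).
Qed.

Lemma al_lt a i j : @Aset R K a -> (i < j)%N -> (j <= K)%N -> al a i < al a j.
Proof.
move=> aA ij jK; apply: (sorted_ltn_nth lt_trans) => //;
  rewrite inE size_breakpoints ltnS //; lia.
Qed.

Lemma al_le a i j : @Aset R K a -> (i <= j)%N -> (j <= K)%N -> al a i <= al a j.
Proof.
move=> aA; rewrite leq_eqVlt => /orP[/eqP->|ij jK]; first by rewrite lexx.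
exact/ltW/al_lt.
Qed.

Lemma al_itv a i : @Aset R K a -> (i <= K)%N -> 0 <= al a i <= 1.
Proof. by move=> aA iK; rewrite -{1}(al0 a) -(alK a) !al_le. Qed.

Lemma al_near a a' h i : 0 <= h -> (forall j, `|a 0 j - a' 0 j| <= h) -> (i <= K)%N ->
  `|al a i - al a' i| <= h.
Proof.
move=> h0 H /(al_case a) [->|->|[j ->]]; rewrite ?al0 ?alK ?alS //;
by rewrite subrr normr0.
Qed.

Lemma md_lt c : (md c < K)%N.
Proof. rewrite /md; lia. Qed.

Lemma cell_code (q : int) i : (i < K)%N -> md (q * K + i%:Z) = i /\ dv (q * K + i%:Z) = q%:~R.
Proof.
move=> iK; rewrite /md /dv divzMDl // modzMDl modz_small ?divz_small //=.
by rewrite addr0.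
Qed.

Lemma code_cell c : exists (q : int) i, (i < K)%N /\ c = q * K + i%:Z.
Proof.
exists (c %/ K)%Z, (md c); split; first exact: md_lt.
by rewrite {1}(divz_eq c K) /md gez0_abs // modz_ge0.
Qed.

(** The value [i = K] is allowed because [a_K = 1] is the breakpoint [a_0 = 0] of the next
    translate. *)
Lemma betE a (q : int) i : (i <= K)%N -> bet a (q * K + i%:Z) = al a i + q%:~R.
Proof.
rewrite leq_eqVlt => /orP[/eqP->|iK].
  have -> : q * K + K%:Z = (q + 1) * K + 0%N%:Z by lia.
  have [m d] := @cell_code (q + 1) 0 isT.
  by rewrite /bet m d al0 alK add0r intrD addrC.
by have [m d] := cell_code q iK; rewrite /bet m d.
Qed.

Lemma bet_succ a c : bet a (c + 1) = al a (md c).+1 + dv c.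
Proof.
have [q [i [iK ->]]] := code_cell c; have [m d] := cell_code q iK.
by rewrite m d -addrA -(@betE a q i.+1) //; congr bet; lia.
Qed.

Lemma bet_unit a c u : @Aset R K a -> bet a c <= u <= bet a (c + 1) -> 0 <= u - dv c <= 1.
Proof.
move=> aA; rewrite bet_succ /bet.
have /andP[h1 _] := al_itv aA (ltnW (md_lt c)); have /andP[_ h2] := al_itv aA (md_lt c).
by move=> /andP[h3 h4]; apply/andP; split; lra.
Qed.

Lemma al_cell a t : @Aset R K a -> 0 <= t < 1 ->
  exists2 i, (i < K)%N & al a i <= t < al a i.+1.
Proof.
move=> aA /andP[t0 t1].
have ex : exists i, t < al a i by exists K; rewrite alK.
case: (ex_minnP ex) => -[|i] ti tmin; first by rewrite al0 ltNge t0 in ti.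
have iK : (i.+1 <= K)%N by apply: tmin; rewrite alK.
exists i => //; rewrite ti andbT leNgt; apply/negP => /tmin; lia.
Qed.

Lemma bet_cell a u : @Aset R K a -> exists c, bet a c <= u < bet a (c + 1).
Proof.
move=> aA; have /andP[u1 u2] := floor_itv u.
have [|i iK /andP[t1 t2]] := @al_cell a (u - (Num.floor u)%:~R) aA.
  by move: u2; rewrite intrD => u2; apply/andP; split; lra.
exists (Num.floor u * K + i%:Z).
rewrite -addrA (_ : i%:Z + 1 = i.+1%:Z) ?betE //; try lia.
by apply/andP; split; lra.
Qed.

Lemma bet_near a a' h c : 0 <= h -> (forall j, `|a 0 j - a' 0 j| <= h) ->
  `|bet a c - bet a' c| <= h.
Proof.
move=> h0 H; rewrite /bet opprD addrACA subrr addr0.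
by apply: al_near => //; apply/ltnW/md_lt.
Qed.

(** One [h] comes from the slope, multiplied by a position in [0,1], the other from the
    intercept. *)
Lemma gm_near a a' b b' la la' l h c u u' : @Aset R K a -> @Aset R K a' ->
  0 <= la <= l -> `|la - la'| <= h -> (forall j, `|b 0 j - b' 0 j| <= h) ->
  bet a c <= u <= bet a (c + 1) -> bet a' c <= u' <= bet a' (c + 1) ->
  `|gm b la c u - gm b' la' c u'| <= l * `|u - u'| + 2 * h.
Proof.
move=> aA aA' /andP[la0 lal] hl hb uc uc'.
have /andP[v1 v2] := bet_unit aA' uc'.
have -> : gm b la c u - gm b' la' c u' = la * (u - u') + (la - la') * (u' - dv c)
    + (b 0 (inord (md c)) - b' 0 (inord (md c))) by rewrite /gm; ring.
rewrite mulr_natl mulr2n [X in _ <= X]addrA; apply: le_trans (ler_normD _ _) _.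
apply: lerD; last exact: hb.
apply: le_trans (ler_normD _ _) _; rewrite !normrM; apply: lerD.
  by rewrite ger0_norm // ler_wpM2r.
rewrite (ger0_norm v1) -[h]mulr1; apply: ler_pM => //.
Qed.

Lemma Fabl_cell a b la i x : @Aset R K a -> (i < K)%N -> al a i <= x < al a i.+1 ->
  @Fabl R K a b la x = la * x + b 0 (inord i).
Proof.
move=> aA iK xi; rewrite /Fabl (big_pred1 (inord i)) // => j /=.
rewrite -/(al a j) -/(al a j.+1).
apply/idP/eqP => [/andP[j1 j2]|->]; last by rewrite inordK.
case/andP: xi => i1 i2.
apply/val_inj; rewrite /= inordK //; apply/eqP; rewrite eqn_leq.
apply/andP; split; rewrite leqNgt; apply/negP => ij.
  have := al_le aA ij (ltnW (ltn_ord j)); move=> h.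
  by have := lt_le_trans i2 (le_trans h j1); rewrite ltxx.
have := al_le aA ij (ltnW iK); move=> h.
by have := lt_le_trans j2 (le_trans h i1); rewrite ltxx.
Qed.

Definition frac (u : R) : R := u - (Num.floor u)%:~R.

Lemma frac_itv u : I01 (frac u).
Proof.
by have := floor_itv u; rewrite /I01 /= /frac intrD => /andP[*]; apply/andP; split; lra.
Qed.

Lemma frac_id u : I01 u -> frac u = u.
Proof.
by move=> u01; rewrite /frac (@floor_def _ u 0) ?subr0.
Qed.

Lemma floor_cell a c u : @Aset R K a -> bet a c <= u < bet a (c + 1) ->
  (Num.floor u)%:~R = dv c.
Proof.
move=> aA; rewrite bet_succ /bet => /andP[h1 h2].
have /andP[h3 _] := al_itv aA (ltnW (md_lt c)); have /andP[_ h4] := al_itv aA (md_lt c).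
congr (_%:~R); apply: floor_def; rewrite intrD.
by move: h1 h2; rewrite /dv => *; apply/andP; split; lra.
Qed.

Lemma fabl_frac a b la c u : @Aset R K a -> bet a c <= u < bet a (c + 1) ->
  @fabl R K a b la (frac u) = frac (gm b la c u).
Proof.
move=> aA uc; rewrite /fabl -/(frac _); congr frac.
have fE := floor_cell aA uc.
rewrite (Fabl_cell b la aA (md_lt c)) /frac fE //.
move: uc; rewrite bet_succ /bet => /andP[*]; apply/andP; split; lra.
Qed.

Lemma iter_fabl a b la u w : @Aset R K a -> tracks (bet a) (gm b la) u w ->
  iter (size w) (@fabl R K a b la) (frac u) = frac (endpoint (gm b la) u w).
Proof.
move=> aA; elim: w u => // c w IH u /= /andP[uc tw].
by rewrite -iterS iterSr (fabl_frac b la aA uc) IH.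
Qed.

Lemma fabl_itv a b la x : I01 (@fabl R K a b la x).
Proof. exact: frac_itv. Qed.

Section Criterion.
Variables (a : 'rV[R]_k) (b : 'rV[R]_K) (la e : R) (n0 : nat).
Hypotheses (aA : @Aset R K a) (la01 : 0 < la < 1) (e0 : 0 < e).
Local Notation f := (@fabl R K a b la).
Hypothesis avoid : forall x i, I01 x -> (i <= K)%N -> e <= `|iter n0 f x - al a i|.

Let good z := I01 z /\ forall i, (i <= K)%N -> e <= `|z - al a i|.

Lemma good_itv z : good z -> e <= z <= 1 - e.
Proof.
move=> [/andP[z0 z1] H]; have := H 0%N isT; have := H K (leqnn _).
rewrite al0 alK subr0 (ger0_norm z0) distrC gtr0_norm ?subr_gt0 //.
by move=> h1 h2; apply/andP; split; lra.
Qed.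

(** No breakpoint separates [z] from [z']. As 0 and 1 count as breakpoints, [f z'] lies in
    [e, 1 - e], so a change of less than [e] does not alter the integer part. *)
Lemma good_step z z' : good z -> good z' -> good (f z') -> `|z - z'| < e ->
  f z - f z' = la * (z - z').
Proof.
move=> gz gz' /good_itv /andP[f1 f2] d; case/andP: la01 => l0 l1.
have [i iK zi] := al_cell aA gz.1; have [j jK zj] := al_cell aA gz'.1.
have ij : i = j.
  case/andP: zi => zi1 zi2; case/andP: zj => zj1 zj2.
  move: d; rewrite ltr_norml => /andP[d1 d2].
  case: (ltngtP i j) => // lij; exfalso.
    have h := al_le aA lij (ltnW jK).
    have := gz.2 j (ltnW jK); rewrite ler0_norm; first lra.
    by rewrite subr_le0; apply: ltW; apply: lt_le_trans zi2 h.
  have h := al_le aA lij (ltnW iK).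
  have := gz'.2 i (ltnW iK); rewrite ler0_norm; first lra.
  by rewrite subr_le0; apply: ltW; apply: lt_le_trans zj2 h.
rewrite -ij in zj.
move: f1 f2; rewrite /fabl (Fabl_cell b la aA iK zi) (Fabl_cell b la aA iK zj).
set m := Num.floor (la * z' + _) => f1 f2.
have -> : Num.floor (la * z + b 0 (inord i)) = m.
  apply: floor_def; rewrite intrD.
  have : `|la * (z - z')| < e.
    by rewrite normrM gtr0_norm //; apply: le_lt_trans d; rewrite ler_piMl // ltW.
  by rewrite ltr_norml => /andP[h1 h2]; apply/andP; split; lra.
ring.
Qed.

(** The closure of the image of [iter n0 f] serves as absorbing set: the inequalities in [good] are
    stable under limits, hence [f] is a local contraction there. *)
Lemma avoid_asymptotically_periodic : asymptotically_periodic f.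
Proof.
case/andP: (la01) => l0 l1.
pose Y := [set iter n0 f x | x in @I01 R]; pose Z := closure Y.
have iterI x : I01 x -> I01 (iter n0 f x).
  by case: n0 => //= n _; apply: fabl_itv.
have Yg y : Y y -> good y.
  by move=> [x x01 <-]; split=> [|i iK]; [apply: iterI | apply: avoid].
have fY y : Y y -> Y (f y).
  by move=> [x x01 <-]; exists (f x); [apply: fabl_itv | rewrite -iterSr].
have Zg z : Z z -> good z.
  move=> /closure_realP Zz; split.
    have [y Yy] := Zz e e0; have /andP[y1 y2] := good_itv (Yg _ Yy).
    by rewrite ltr_norml => /andP[d1 d2]; apply/andP; split; lra.
  move=> i iK; apply/ler_addgt0Pr => d d0; have [y Yy zy] := Zz d d0.
  have := (Yg _ Yy).2 i iK; have := ler_distD z y (al a i).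
  rewrite (distrC y z); lra.
have fZ z : Z z -> Z (f z).
  move=> Zz; apply/closure_realP => d d0.
  have [|y Yy] := (closure_realP _ _).1 Zz (Num.min e d); first by rewrite lt_min e0.
  rewrite lt_min => /andP[d1 d2]; exists (f y); first exact: fY.
  rewrite good_step //; [|exact: Zg|exact: Yg|exact/Yg/fY].
  by rewrite normrM gtr0_norm //; apply: le_lt_trans d2; rewrite ler_piMl // ltW.
apply: (@contracting_asymptotically_periodic R f Z la e n0) => //.
- by rewrite ltW.
- by move=> z /Zg[].
- exact: closed_closure.
- move=> z z' Zz Zz' d; rewrite good_step ?normrM ?(gtr0_norm l0) //; try exact: Zg.
  exact/Zg/fZ.
- by move=> x x01; apply: subset_closure; exists x.
Qed.

End Criterion.

Lemma not_periodic_hits a b la e n : @Aset R K a -> 0 < la < 1 -> 0 < e ->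
  ~ asymptotically_periodic (@fabl R K a b la) ->
  exists x w c, [/\ I01 x, size w = n, tracks (bet a) (gm b la) x w &
     `|endpoint (gm b la) x w - bet a c| < e].
Proof.
move=> aA la01 e0 nAP.
have [x [i [x01 iK close]]] : exists x i, [/\ I01 x, (i <= K)%N &
    `|iter n (@fabl R K a b la) x - al a i| < e].
  apply: contrapT => H; apply: nAP.
  apply: (@avoid_asymptotically_periodic a b la e n) => // x i x01 iK.
  by rewrite leNgt; apply/negP => h; apply: H; exists x, i.
have [w sw tw] := exists_tracks (gm b la) (fun u => bet_cell u aA) x n.
set u := endpoint (gm b la) x w.
(* The copy of [a_i] in the unit interval that contains [u]. *)
exists x, w, (Num.floor u * K + i%:Z); split=> //.
move: close; rewrite -{1}(frac_id x01) -sw (iter_fabl aA tw) -/u betE // /frac.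
by rewrite opprD addrA addrAC.
Qed.

End LiftedDynamics.

(** * The slab estimate for a fixed word *)

Section Slab.
Variables (R : realType) (k : nat).
Local Notation K := k.+1.
Local Notation dv := (@dv R k).
Local Notation md := (@md k).
Implicit Types (a : 'rV[R]_k) (b : 'rV[R]_K) (la h s u : R) (c : int).

(** At each letter the difference of the two orbits is multiplied by [la] and gains at least
    [s - 2 * h]: [s - h] from the intercepts, less at most [h] from the slopes. *)
Lemma endpoint_growth a a' b b' la la' h s u u' w : @Aset R K a -> @Aset R K a' ->
  0 <= la -> `|la - la'| <= h -> (forall i, s - h <= b' 0 i - b 0 i) ->
  ctracks (bet a) (gm b la) u w -> ctracks (bet a') (gm b' la') u' w ->
  la ^+ size w * (u' - u) + (s - 2 * h) * \sum_(j < size w) la ^+ j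
    <= endpoint (gm b' la') u' w - endpoint (gm b la) u w.
Proof.
move=> aA aA' la0 hl hb; elim: w u u' => [|c w IH] u u' /=.
  by rewrite big_ord0 mulr0 addr0 expr0 mul1r lexx.
move=> /andP[cu tw] /andP[cu' tw']; apply: le_trans (IH _ _ tw tw').
have /andP[v1 v2] := bet_unit aA' cu'.
have step : la * (u' - u) + (s - 2 * h) <= gm b' la' c u' - gm b la c u.
  have -> : gm b' la' c u' - gm b la c u = la * (u' - u) + (la' - la) * (u' - dv c)
    + (b' 0 (inord (md c)) - b 0 (inord (md c))) by rewrite /gm; ring.
  have := hb (inord (md c)).
  have : `|(la' - la) * (u' - dv c)| <= h.
    rewrite normrM (ger0_norm v1) distrC -[h]mulr1.
    by apply: ler_pM.
  by rewrite ler_norml => /andP[? _] ?; lra.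
have := ler_wpM2l (exprn_ge0 (size w) la0) step.
rewrite big_ord_recr /= exprSr; lra.
Qed.

(** The endpoints differ by at most [3 * h]: each is within [h] of its breakpoint, and the
    breakpoints differ by at most [h]. A shift [s >= 2 * h] produces a difference of at least
    [s - 2 * h - h], the last [h] being due to the starting points; hence the 6. *)
Lemma slab a a' b b' la la' h u u' w c : @Aset R K a -> @Aset R K a' ->
  0 <= la -> `|la - la'| <= h -> (forall j, `|a 0 j - a' 0 j| <= h) ->
  (forall i, `|(b 0 i - b 0 0) - (b' 0 i - b' 0 0)| <= h) ->
  (0 < size w)%N -> la ^+ size w * `|u - u'| <= h ->
  ctracks (bet a) (gm b la) u w -> ctracks (bet a') (gm b' la') u' w ->
  `|endpoint (gm b la) u w - bet a c| <= h ->
  `|endpoint (gm b' la') u' w - bet a' c| <= h -> b' 0 0 - b 0 0 <= 6 * h.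
Proof.
move=> aA aA' la0 hl ha hb w0 hu tw tw' ew ew'.
have h0 : 0 <= h := le_trans (normr_ge0 _) hl.
have hb' i : b' 0 0 - b 0 0 - h <= b' 0 i - b 0 i.
  by have := hb i; rewrite ler_norml => /andP[]; lra.
have := endpoint_growth aA aA' la0 hl hb' tw tw'.
have S1 : 1 <= \sum_(j < size w) la ^+ j.
  case: (size w) w0 => // n _; rewrite big_ord_recl expr0 lerDl.
  by apply: sumr_ge0 => j _; rewrite exprn_ge0.
have := bet_near c h0 ha; move: ew ew'.
rewrite !ler_norml => /andP[e1 e2] /andP[e3 e4] /andP[b1 b2] g.
have g2 : - h <= la ^+ size w * (u' - u).
  have := ler_norm (u - u'); have := exprn_ge0 (size w) la0; nra.
rewrite leNgt; apply/negP => H.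
have : b' 0 0 - b 0 0 - 2 * h <= (b' 0 0 - b 0 0 - 2 * h) * \sum_(j < size w) la ^+ j.
  by rewrite ler_peMr //; lra.
lra.
Qed.

End Slab.

(** * Null sets through box covers *)

Section NullSets.
Variables (R : realType) (n : nat).
Hypothesis n_gt0 : (0 < n)%N.
Implicit Types (A : set 'rV[R]_n) (rho e h D : R).

Definition is_box (lu : 'rV[R]_n * 'rV[R]_n) := forall i, lu.1 0 i <= lu.2 0 i.

Definition vol (lu : 'rV[R]_n * 'rV[R]_n) : R := box_vol lu.1 lu.2.

Lemma vol_ge0 lu : is_box lu -> 0 <= vol lu.
Proof. by move=> H; apply: prodr_ge0 => i _; rewrite subr_ge0. Qed.

(** Degenerate boxes pad finite or partially indexed covers; in dimension 0 the empty product would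
    give them volume 1. *)
Lemma vol_point : vol (0, 0) = 0.
Proof. by rewrite /vol /box_vol (bigD1 (Ordinal n_gt0)) //= subrr mul0r. Qed.

(** Bounding all finite partial sums replaces infinite series, so that countable unions only
    rearrange finite sums. *)
Definition null A := forall e, 0 < e -> exists lu : nat -> 'rV[R]_n * 'rV[R]_n,
  [/\ forall j, is_box (lu j), A `<=` \bigcup_j box (lu j).1 (lu j).2 &
      forall m, \sum_(j < m) vol (lu j) <= e].

Lemma null_sub A B : A `<=` B -> null B -> null A.
Proof.
move=> AB H e e0; have [lu [h1 h2 h3]] := H e e0.
by exists lu; split=> //; apply: subset_trans h2.
Qed.

Lemma null_lebesgue_outer A : null A -> lebesgue_outer A = 0%E.
Proof.
move=> H; apply/eqP; rewrite eq_le; apply/andP; split; last first.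
  apply: le_ereal_inf_tmp => _ [lu [hlu _] <-]; apply: nneseries_ge0 => j _ _.
  by rewrite lee_fin; apply: vol_ge0 => i; apply: hlu.
apply/lee_addgt0Pr => e e0; rewrite add0e.
have [lu [h1 h2 h3]] := H e e0.
apply: ereal_inf_le; exists (\sum_(j <oo) (box_vol (lu j).1 (lu j).2)%:E)%E.
  by exists lu.
apply: lime_le.
  by apply: is_cvg_nneseries => j _ _; rewrite lee_fin; apply: vol_ge0.
by apply: nearW => m; rewrite sumEFin lee_fin big_mkord; apply: h3.
Qed.

Lemma sum_uniq_sub (I : eqType) (s s' : seq I) (F : I -> R) : (forall i, 0 <= F i) ->
  uniq s -> {subset s <= s'} -> \sum_(i <- s) F i <= \sum_(i <- s') F i.
Proof.
move=> F0; elim: s s' => [|x s IH] s' /=; first by rewrite big_nil sumr_ge0.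
move=> /andP[xs us] sub.
have xs' : x \in s' by apply: sub; rewrite inE eqxx.
rewrite big_cons (perm_big _ (perm_to_rem xs')) big_cons lerD2l.
apply: IH us _ => y ys.
have : y \in x :: rem x s' by rewrite -(perm_mem (perm_to_rem xs')) sub // inE ys orbT.
by rewrite inE => /orP[/eqP yx|//]; rewrite yx (negPf xs) in ys.
Qed.

Lemma half_sums e m : 0 <= e -> \sum_(i <- iota 0 m) e / 2 ^+ i.+1 <= e.
Proof.
move=> e0; suff -> : \sum_(i <- iota 0 m) e / 2 ^+ i.+1 = e - e / 2 ^+ m.
  by rewrite gerBl divr_ge0 // exprn_ge0.
elim: m => [|m IH]; first by rewrite big_nil expr0 divr1 subrr.
rewrite -addn1 iotaD big_cat /= big_seq1 IH add0n addn1 exprS.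
field.
by rewrite expf_neq0 // pnatr_eq0.
Qed.

Lemma null_bigcup_nat (A : nat -> set 'rV[R]_n) :
  (forall i, null (A i)) -> null (\bigcup_i A i).
Proof.
move=> H e e0.
have he i : 0 < e / 2 ^+ i.+1 by rewrite divr_gt0 // exprn_gt0.
pose lu i := projT1 (cid (H i _ (he i))).
have luP i : [/\ forall j, is_box (lu i j), A i `<=` \bigcup_j box (lu i j).1 (lu i j).2 &
   forall m, \sum_(j < m) vol (lu i j) <= e / 2 ^+ i.+1].
  by rewrite /lu; case: cid.
(* The double sequence of boxes as a single one, with a box of volume 0 at the numbers that code no
   pair. *)
pose L j := if @pickle_inv (nat * nat)%type j is Some p then lu p.1 p.2 else (0, 0).
exists L; split.
- move=> j; rewrite /L; case: pickle_inv => [p|]; last by move=> i; rewrite /= mxE.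
  by have [+ _ _] := luP p.1; apply.
- move=> x [i _ Aix]; have [_ sub _] := luP i; have [j _ xj] := sub _ Aix.
  by exists (pickle (i, j)) => //; rewrite /L pickleK_inv.
- move=> m.
  pose F (p : nat * nat) := vol (lu p.1 p.2).
  have F0 p : 0 <= F p by apply: vol_ge0; have [+ _ _] := luP p.1; apply.
  pose s := pmap (@pickle_inv (nat * nat)%type) (iota 0 m).
  have -> : \sum_(j < m) vol (L j) = \sum_(p <- s) F p.
    rewrite big_pmap -(big_mkord predT (fun j => vol (L j))).
    rewrite /index_iota subn0; apply: eq_bigr => j _; rewrite /L.
    by case: pickle_inv => //=; rewrite vol_point.
  (* The square of side [M] contains all pairs coded by the first [m] numbers, and its rows are
     bounded by [e / 2 ^+ i.+1]. *)
  pose M := (\max_(p <- s) maxn p.1 p.2).+1.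
  apply: le_trans (sum_uniq_sub F0 (s' := [seq (i, j) | i <- iota 0 M, j <- iota 0 M]) _ _) _.
  - exact: (pmap_uniq (@pickle_invK (nat * nat)%type) (iota_uniq 0 m)).
  - move=> [i j] ps; have := @leq_bigmax_seq _ s xpredT (fun p => maxn p.1 p.2) (i, j) ps isT.
    rewrite [X in (X <= _)%N -> _]/= geq_max => /andP[h1 h2].
    by apply: (@allpairs_f _ _ _ pair); rewrite !mem_iota /= !add0n !ltnS.
  rewrite big_allpairs; apply: le_trans (half_sums M (ltW e0)).
  apply: ler_sum => i _; have [_ _ h] := luP i.
  have := h M; rewrite -(big_mkord predT (fun j => vol (lu i j))) /index_iota subn0.
  by apply.
Qed.

Lemma null_bigcup (T : countType) (A : T -> set 'rV[R]_n) :
  (forall i, null (A i)) -> null (\bigcup_i A i).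
Proof.
move=> H; pose B j := if @unpickle T j is Some t then A t else set0.
apply: (@null_sub _ (\bigcup_j B j)).
  by move=> x [t _ Atx]; exists (pickle t) => //; rewrite /B pickleK.
apply: null_bigcup_nat => j; rewrite /B; case: unpickle => [t|]; first exact: H.
move=> e e0; exists (fun=> (0, 0)); split=> [_ i|//|m]; first by rewrite /= mxE.
by rewrite big1 ?ltW // => i _; rewrite vol_point.
Qed.

Definition covered_by A (m : nat) rho := exists s : seq 'rV[R]_n,
  (size s <= m)%N /\ forall x, A x -> exists2 c, c \in s & forall i, `|x 0 i - c 0 i| <= rho.

Lemma covered_null A :
  (forall e, 0 < e -> exists m rho, [/\ 0 <= rho, covered_by A m rho &
     m%:R * (2 * rho) ^+ n <= e]) -> null A.
Proof.
move=> H e e0; have [m [rho [r0 [s [sm cov]]] he]] := H e e0.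
pose lu j := if (j < size s)%N then (s`_j - const_mx rho, s`_j + const_mx rho)
   else (0 : 'rV[R]_n, 0 : 'rV[R]_n).
have volE j : vol (lu j) = if (j < size s)%N then (2 * rho) ^+ n else 0.
  rewrite /lu; case: ifP => _; last exact: vol_point.
  rewrite /vol /box_vol /= (eq_bigr (fun=> 2 * rho)) ?prodr_const ?card_ord // => i _.
  by rewrite !mxE; ring.
have v0 : 0 <= (2 * rho) ^+ n by rewrite exprn_ge0 // mulr_ge0.
exists lu; split.
- move=> j i; rewrite /lu; case: ifP => _ /=; rewrite !mxE //; lra.
- move=> x /cov[c cs xc]; exists (index c s) => //=.
  rewrite /lu index_mem cs /= nth_index // => i; have := xc i.
  by rewrite !mxE ler_norml => /andP[*]; apply/andP; split; lra.
- move=> M; apply: le_trans he.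
  apply: (@le_trans _ _ ((minn M (size s))%:R * (2 * rho) ^+ n)); last first.
    by rewrite ler_wpM2r // ler_nat; apply: leq_trans (geq_minr _ _) sm.
  elim: M => [|M IH]; first by rewrite big_ord0 min0n mul0r.
  rewrite big_ord_recr /= volE; case: ltnP => Ms.
    have -> : minn M.+1 (size s) = (minn M (size s)).+1 by lia.
    rewrite -[(minn _ _).+1%:R]natr1 [leRHS]mulrDl mul1r lerD2r; exact: IH.
  have -> : minn M.+1 (size s) = minn M (size s) by lia.
  by rewrite addr0.
Qed.

Lemma covered_union (I : eqType) (L : seq I) (A : I -> set 'rV[R]_n) m rho :
  (forall i, i \in L -> covered_by (A i) m rho) ->
  covered_by [set x | exists2 i, i \in L & A i x] (size L * m)%N rho.
Proof.
elim: L => [|i L IH] H; first by exists [::]; split=> // x [].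
have [|s [hs cs]] := IH; first by move=> j jL; apply: H; rewrite inE jL orbT.
have [|s' [hs' cs']] := H i; first by rewrite inE eqxx.
exists (s' ++ s); split; first by rewrite size_cat /= mulSn leq_add.
move=> x [j + Ax]; rewrite inE => /orP[/eqP ji|jL].
  by rewrite ji in Ax; have [c c1 c2] := cs' x Ax; exists c; rewrite // mem_cat c1.
have [|c c1 c2] := cs x; first by exists j.
by exists c; rewrite // mem_cat c1 orbT.
Qed.

(** Sort the points of [A] by their keys rounded to multiples of [h]; one representative per class
    is enough. The gain comes from using fewer keys than coordinates. *)
Lemma thin_covered A N (key : 'I_N -> 'rV[R]_n -> R) h D rho : 0 < h -> 0 <= D ->
  (forall x y j, A x -> A y -> `|key j x - key j y| <= D) ->
  (forall x y, A x -> A y -> (forall j, `|key j x - key j y| <= h) ->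
     forall i, `|x 0 i - y 0 i| <= rho) ->
  covered_by A ((Num.trunc (2 * D / h)).+1 ^ N) rho.
Proof.
move=> h0 D0 osc thin.
have [[x0 Ax0]|noA] := pselect (exists x, A x); last first.
  by exists [::]; split=> // x Ax; exfalso; apply: noA; exists x.
set M := Num.trunc (2 * D / h).
pose t j x := (key j x - key j x0 + D) / h.
have tb j x : A x -> 0 <= t j x <= 2 * D / h.
  move=> Ax; have := osc _ _ j Ax Ax0; rewrite ler_norml => /andP[h1 h2].
  by rewrite /t divr_ge0 /=; [rewrite ler_pM2r ?invr_gt0 //; lra | lra | exact: ltW].
pose phi x : {ffun 'I_N -> 'I_M.+1} := [ffun j => inord (Num.trunc (t j x))].
(* For an empty class this is the irrelevant point [x0]. *)
pose rep f := xget x0 [set x | A x /\ phi x = f].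
exists [seq rep f | f <- enum {: {ffun 'I_N -> 'I_M.+1}}]; split.
  by rewrite size_map -cardE card_ffun !card_ord.
move=> x Ax; exists (rep (phi x)); first by apply: map_f; rewrite mem_enum.
have [Ar pr] : [set y | A y /\ phi y = phi x] (rep (phi x)).
  by apply: xgetPex; exists x.
apply: thin => // j.
have /ffunP /(_ j) := pr; rewrite !ffunE => /(congr1 val) /=.
have bd y : A y -> (Num.trunc (t j y) < M.+1)%N.
  by move=> /(tb j) /andP[_ h1]; rewrite ltnS le_truncn.
rewrite !inordK ?bd // => E.
have /andP[x1 _] := tb j x Ax; have /andP[r1 _] := tb j _ Ar.
have /andP[x2 x3] := truncn_itv x1; have /andP[r2 r3] := truncn_itv r1.
rewrite E in r2 r3; move: x2 x3 r2 r3; rewrite -natr1; set T := (_%:R : R).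
move=> x2 x3 r2 r3.
have -> : key j x - key j (rep (phi x)) = (t j x - t j (rep (phi x))) * h.
  by rewrite /t; field; lra.
rewrite normrM (gtr0_norm h0) -[X in _ <= X]mul1r ler_wpM2r ?(ltW h0) // ler_norml.
by apply/andP; split; lra.
Qed.

End NullSets.

(** * The parameter space and breakpoint connections *)

Section ParameterSpace.
Variables (R : realType) (k : nat).
Local Notation K := k.+1.
Local Notation n := (k + K + 1)%N.
Implicit Types (x y : 'rV[R]_n) (h r u : R) (w : seq int) (c : int).

Definition pa x : 'rV[R]_k := lsubmx (lsubmx x).
Definition pb x : 'rV[R]_K := rsubmx (lsubmx x).
Definition pl x : R := rsubmx x 0 0.

Definition admissible x := @Aset R K (pa x) /\ 0 < pl x < 1.

Definition xbet x : int -> R := bet (pa x).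
Definition xgm x : int -> R -> R := gm (pb x) (pl x).

(* Moving all [b_i] together moves every orbit but no breakpoint; these are the
   other coordinates. *)
Definition key (j : 'I_(k + k + 1)) x : R :=
  match fintype.split j with
  | inl j' => match fintype.split j' with
              | inl i => pa x 0 i
              | inr i => pb x 0 (lift ord0 i) - pb x 0 0
              end
  | inr _ => pl x
  end.

Lemma coordP (P : R -> R -> Prop) x y :
  (forall i, P (pa x 0 i) (pa y 0 i)) -> (forall i, P (pb x 0 i) (pb y 0 i)) ->
  P (pl x) (pl y) -> forall i, P (x 0 i) (y 0 i).
Proof.
rewrite /pa /pb /pl => Ha Hb Hl i.
case: (split_ordP i) => [j ->|j ->].
  case: (split_ordP j) => [i' ->|i' ->].
    by have := Ha i'; rewrite !mxE.
  by have := Hb i'; rewrite !mxE.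
by move: Hl; rewrite !mxE ord1.
Qed.

Lemma coord_near h x y : (forall i, `|x 0 i - y 0 i| <= h) ->
  [/\ forall j, `|pa x 0 j - pa y 0 j| <= h, forall i, `|pb x 0 i - pb y 0 i| <= h &
      `|pl x - pl y| <= h].
Proof. by move=> H; split=> *; rewrite /pa /pb /pl !mxE; apply: H. Qed.

Lemma key_near h x y j : 0 <= h -> (forall i, `|x 0 i - y 0 i| <= h) ->
  `|key j x - key j y| <= 2 * h.
Proof.
move=> h0 /coord_near[Ha Hb Hl].
have h2 : h <= 2 * h by lra.
rewrite /key; case: (fintype.split j) => [j'|_]; last exact: le_trans Hl h2.
case: (fintype.split j') => [i|i]; first exact: le_trans (Ha i) h2.
have := Hb (lift ord0 i); have := Hb 0.
rewrite !ler_norml => /andP[h3 h4] /andP[h5 h6]; apply/andP; split; lra.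
Qed.

Lemma keys_near h x y : (forall j, `|key j x - key j y| <= h) ->
  [/\ forall j, `|pa x 0 j - pa y 0 j| <= h,
      forall i, `|(pb x 0 i - pb x 0 0) - (pb y 0 i - pb y 0 0)| <= h &
      `|pl x - pl y| <= h].
Proof.
move=> H; have Hl : `|pl x - pl y| <= h.
  by have := H (rshift (k + k) ord0); rewrite /key; case: splitP => [j /=|//]; have := ltn_ord j; lia.
split=> // [j|i].
  by have := H (lshift 1 (lshift k j)); rewrite /key -!/(unsplit (inl _)) !unsplitK.
case: (unliftP 0 i) => [i' ->|->]; last by rewrite !subrr normr0 (le_trans (normr_ge0 _) Hl).
have := H (lshift 1 (rshift k i')); rewrite /key -/(unsplit (inl (rshift _ _))) unsplitK.
by rewrite -/(unsplit (inr _)) unsplitK.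
Qed.

Lemma n_gt0 : (0 < n)%N. Proof. by rewrite addn1. Qed.

Lemma nE : n = (k + k + 1).+1. Proof. by lia. Qed.

(** The estimate [slab] is one-sided, so it is applied in both directions. It gives [6 * h] for the
    first intercept, and the keys add [h] for the other ones. *)
Lemma slab_box h x y u u' w c : admissible x -> admissible y ->
  (forall j, `|key j x - key j y| <= h) -> (0 < size w)%N ->
  pl x ^+ size w * `|u - u'| <= h -> pl y ^+ size w * `|u - u'| <= h ->
  ctracks (xbet x) (xgm x) u w -> ctracks (xbet y) (xgm y) u' w ->
  `|endpoint (xgm x) u w - xbet x c| <= h ->
  `|endpoint (xgm y) u' w - xbet y c| <= h ->
  forall i, `|x 0 i - y 0 i| <= 7 * h.
Proof.
move=> [xA /andP[x0 _]] [yA /andP[y0 _]] /keys_near[Ha Hb Hl] w0 hu hu' tx ty ex ey.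
have h0 : 0 <= h := le_trans (normr_ge0 _) Hl.
have h7 : h <= 7 * h by lra.
have s1 := slab xA yA (ltW x0) Hl Ha Hb w0 hu tx ty ex ey.
have s2 : pb x 0 0 - pb y 0 0 <= 6 * h.
  apply: (slab yA xA (ltW y0) _ _ _ w0 _ ty tx ey ex); first by rewrite distrC.
  - by move=> j; rewrite distrC.
  - by move=> i; rewrite distrC.
  - by rewrite distrC.
apply: (coordP (P := fun s t => `|s - t| <= 7 * h)) => [i|i|]; try exact: le_trans h7.
have := Hb i; rewrite !ler_norml => /andP[b1 b2].
apply/andP; split; lra.
Qed.

Definition gridcell r (z : {ffun 'I_n -> int}) : set 'rV[R]_n :=
  [set x | forall i, Num.floor (x 0 i / r) = z i].

Lemma gridcell_near r z x y : 0 < r -> gridcell r z x -> gridcell r z y ->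
  forall i, `|x 0 i - y 0 i| <= r.
Proof.
move=> r0 xz yz i.
have := floor_itv (x 0 i / r); have := floor_itv (y 0 i / r).
rewrite xz yz intrD => /andP[y1 y2] /andP[x1 x2].
have -> : x 0 i - y 0 i = (x 0 i / r - y 0 i / r) * r by field; lra.
rewrite normrM (gtr0_norm r0) -[X in _ <= X]mul1r ler_wpM2r ?(ltW r0) // ler_norml.
by apply/andP; split; lra.
Qed.

Lemma null_gridcells r (A : set 'rV[R]_n) : (forall z, null (A `&` gridcell r z)) -> null A.
Proof.
move=> H; apply: (@null_sub R n _ (\bigcup_z (A `&` gridcell r z))).
  by move=> x Ax; exists [ffun i => Num.floor (x 0 i / r)] => //; split=> // i; rewrite ffunE.
exact: (null_bigcup n_gt0).
Qed.

(** There is one key fewer than coordinates, so exactly one factor [h] survives. *)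
Lemma thin_volume D h : 0 <= D -> 0 < h <= 1 ->
  ((Num.trunc (2 * D / h)).+1 ^ (k + k + 1))%:R * (2 * (7 * h)) ^+ n
    <= (2 * D + 1) ^+ (k + k + 1) * 14 ^+ n * h.
Proof.
move=> D0 /andP[h0 h1].
have m1 : (Num.trunc (2 * D / h)).+1%:R * h <= 2 * D + 1.
  have /truncn_itv /andP[+ _] : 0 <= 2 * D / h by rewrite divr_ge0 ?(ltW h0) ?mulr_ge0.
  rewrite -natr1 ler_pdivlMr // mulrDl mul1r => ?; lra.
have -> : 2 * (7 * h) = 14 * h by ring.
rewrite natrX [(14 * h) ^+ _]exprMn {2}nE exprSr.
set m := (_.+1%:R) in m1 *.
have -> : m ^+ (k + k + 1) * (14 ^+ n * (h ^+ (k + k + 1) * h)) =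
  (m * h) ^+ (k + k + 1) * (14 ^+ n * h) by rewrite exprMn; ring.
rewrite -mulrA; apply: ler_wpM2r; first by rewrite mulr_ge0 ?exprn_ge0 // ltW.
by apply: lerXn2r; rewrite ?nnegrE ?mulr_ge0 //; lra.
Qed.

(* Parameters for which a one-sided orbit of a breakpoint hits a breakpoint again. *)
Definition connection c (left : bool) w c' : set 'rV[R]_n :=
  [set x | [/\ admissible x, ctracks (xbet x) (xgm x) (xbet x (c + left%:Z)) (c :: w) &
     endpoint (xgm x) (xbet x (c + left%:Z)) (c :: w) = xbet x c']].

(** For an exact hit along one fixed word the slab estimate holds at every thickness [h]. The
    starting points need no separate control: they are breakpoints, hence governed by the keys. *)
Lemma connection_null c left w c' : null (connection c left w c').
Proof.
apply: (@null_gridcells 1) => z; apply: (covered_null n_gt0) => e e0.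
pose C : R := (2 * 2 + 1) ^+ (k + k + 1) * 14 ^+ n.
have C0 : 0 <= C by rewrite mulr_ge0 ?exprn_ge0.
pose h := Num.min 1 (e / (C + 1)).
have h0 : 0 < h by rewrite lt_min ltr01 divr_gt0 //; lra.
have h1 : h <= 1 by rewrite ge_min lexx.
exists ((Num.trunc (2 * 2 / h)).+1 ^ (k + k + 1))%N, (7 * h); split.
- by rewrite mulr_ge0 // ltW.
- apply: (thin_covered (key := key)) => //.
    move=> x y j [_ xz] [_ yz]; rewrite -[X in _ <= X]mulr1; apply: key_near => //.
    exact: gridcell_near xz yz.
  move=> x y [[xA tx ex] xz] [[yA ty ey] yz] kxy.
  have [Ha _ _] := keys_near kxy.
  have bn := bet_near (c + left%:Z) (ltW h0) Ha.
  have pw z' m : admissible z' -> pl z' ^+ m * `|xbet x (c + left%:Z) - xbet y (c + left%:Z)| <= h.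
    move=> [_ /andP[z0 z1]]; apply: le_trans bn.
    by rewrite ler_piMl // exprn_ile1 // ltW.
  apply: (slab_box (c := c') xA yA kxy _ (pw _ _ xA) (pw _ _ yA) tx ty) => //.
  + by rewrite ex subrr normr0 ltW.
  + by rewrite ey subrr normr0 ltW.
- apply: le_trans (thin_volume _ _) _ => //; first by rewrite h0.
  rewrite -/C; apply: (@le_trans _ _ (C * (e / (C + 1)))).
    by rewrite ler_wpM2l // ge_min lexx orbT.
  rewrite mulrA ler_pdivrMr; last lra.
  nra.
Qed.

End ParameterSpace.

Section FarFacts.
Variables (R : realType) (bet : int -> R) (G : int -> R -> R).

Lemma far_mono eta eta' u w : eta' <= eta -> far bet G eta u w -> far bet G eta' u w.
Proof.
move=> h; elim: w u => //= c w IH u /andP[/andP[u1 u2] /IH ->].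
by rewrite andbT; apply/andP; split; lra.
Qed.

Lemma tracks_far u w : tracks bet G u w ->
  (forall j c, (j < size w)%N -> endpoint G u (take j w) <> bet c) ->
  exists2 eta, 0 < eta & far bet G eta u w.
Proof.
elim: w u => [|c w IH] u /=; first by exists 1.
move=> /andP[/andP[u1 u2] tw] H.
have [|eta e0 fw] := IH _ tw; first by move=> j d jw; apply: (H j.+1).
have u3 : bet c < u.
  by rewrite lt_neqAle u1 andbT; apply/eqP => E; apply: (H 0%N c) => //=.
exists (Num.min eta (Num.min (u - bet c) (bet (c + 1) - u))).
  by rewrite !lt_min e0 !subr_gt0 u3 u2.
apply/andP; split.
  have h1 : Num.min eta (Num.min (u - bet c) (bet (c + 1) - u)) <= u - bet c.
    by rewrite !ge_min lexx orbT.
  have h2 : Num.min eta (Num.min (u - bet c) (bet (c + 1) - u)) <= bet (c + 1) - u.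
    by rewrite !ge_min lexx !orbT.
  by apply/andP; split; lra.
by apply: far_mono fw; rewrite ge_min lexx.
Qed.

End FarFacts.

(** * The exceptional set is null *)

Section NullExceptional.
Variables (R : realType) (k : nat).
Local Notation K := k.+1.
Local Notation n := (k + K + 1)%N.
Implicit Types (x y : 'rV[R]_n) (h r u e l eta : R) (w : seq int) (c : int).
Local Notation admissible := (@admissible R k).
Local Notation md := (@md k).

Lemma xbet_lt x c : admissible x -> xbet x c < xbet x (c + 1).
Proof.
move=> [xA _]; rewrite /xbet bet_succ /bet ltrD2r; apply: al_lt => //.
exact: md_lt.
Qed.

Lemma xbet_le x c d : admissible x -> c <= d -> xbet x c <= xbet x d.
Proof.
move=> xA cd; have -> : d = c + `|d - c|%N%:Z by lia.
elim: `|d - c|%N => [|m IH]; first by rewrite addr0.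
apply: le_trans IH _; apply: ltW.
have -> : c + m.+1%:Z = (c + m%:Z) + 1 by lia.
exact: xbet_lt.
Qed.

(** The value of the [i]-th branch at its left end or, as a limit from the left, at its right end.
    It involves [i] only, so that finitely many cases settle all cells of the line. *)
Definition side_value x i (left : bool) : R := pl x * al (pa x) (i + left) + pb x 0 (inord i).

Lemma side_valueE x c (left : bool) :
  xgm x c (xbet x (c + left%:Z)) = side_value x (md c) left.
Proof.
rewrite /xgm /gm /xbet /side_value; congr (_ * _ + _); case: left.
  by rewrite bet_succ addrK addn1.
by rewrite addr0 addn0 /bet addrK.
Qed.

Definition generic N eta x := forall c (left : bool), exists2 w, size w = N &
  far (xbet x) (xgm x) eta (xgm x c (xbet x (c + left%:Z))) w.

Definition gapped eta x := forall c, xbet x c + eta <= xbet x (c + 1).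

(** The one-sided orbits meet no breakpoint, so each is at a positive distance from them for [N]
    steps; [eta] is the minimum over the two sides and the gap of each of the [K] branches. *)
Lemma no_connection_generic x N : admissible x ->
  (forall c left w c', ~ connection c left w c' x) ->
  exists eta, [/\ 0 < eta, gapped eta x & generic N eta x].
Proof.
move=> xA noc; have [aA _] := xA.
have side i left : (i < K)%N -> exists2 eta, 0 < eta &
    exists2 w, size w = N & far (xbet x) (xgm x) eta (side_value x i left) w.
  move=> iK; have [w sw tw] := exists_tracks (xgm x) (fun u => bet_cell u aA) (side_value x i left) N.
  have [mdi _] := @cell_code R k 0 i iK; rewrite mul0r add0r in mdi.
  have [j c' jw E|eta e0 fw] := tracks_far tw; last by exists eta => //; exists w.
  apply: (noc i%:Z left (take j w) c'); rewrite /connection /=; split=> //.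
    apply/andP; split.
      by case: left {tw E}; rewrite ?addr0 ?lexx /= ?andbT; [rewrite ltW //= xbet_lt|exact/ltW/xbet_lt].
    rewrite side_valueE mdi; apply: tracks_ctracks.
    by move: tw; rewrite -{1}(cat_take_drop j w) tracks_cat => /andP[].
  by rewrite side_valueE mdi.
have bound M : (M <= K)%N -> exists2 eta, 0 < eta & forall i, (i < M)%N ->
    al (pa x) i + eta <= al (pa x) i.+1 /\ forall left,
    exists2 w, size w = N & far (xbet x) (xgm x) eta (side_value x i left) w.
  elim: M => [|M IH] MK; first by exists 1.
  have [eta1 p1 H1] := IH (ltnW MK).
  have [eta2 p2 [w2 s2 f2]] := side M true MK.
  have [eta3 p3 [w3 s3 f3]] := side M false MK.
  have g : 0 < al (pa x) M.+1 - al (pa x) M by rewrite subr_gt0 al_lt.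
  exists (Num.min (Num.min eta1 eta2) (Num.min eta3 (al (pa x) M.+1 - al (pa x) M))).
    by rewrite !lt_min p1 p2 p3.
  set eta := Num.min _ _.
  have l1 : eta <= eta1 by rewrite !ge_min lexx.
  have l2 : eta <= eta2 by rewrite !ge_min lexx !orbT.
  have l3 : eta <= eta3 by rewrite !ge_min lexx !orbT.
  have l4 : eta <= al (pa x) M.+1 - al (pa x) M by rewrite !ge_min lexx !orbT.
  move=> i; rewrite ltnS leq_eqVlt => /orP[/eqP->|/H1[h1 h2]].
    split=> [|[]]; first by lra.
      by exists w2 => //; apply: far_mono f2.
    by exists w3 => //; apply: far_mono f3.
  split=> [|left]; first by lra.
  by have [w sw fw] := h2 left; exists w => //; apply: far_mono fw.
have [eta e0 H] := bound K (leqnn _).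
exists eta; split=> // [c|c left].
  have [h _] := H _ (md_lt k c); rewrite /xbet bet_succ /bet; lra.
by rewrite side_valueE; have [_] := H _ (md_lt k c); apply.
Qed.

Definition recurrent x := forall m e, 0 < e -> exists u w c,
  [/\ I01 u, size w = m, tracks (xbet x) (xgm x) u w & `|endpoint (xgm x) u w - xbet x c| < e].

(** Fixing [l], [N] and [eta] makes the counting argument uniform over the set. *)
Definition wild l N eta : set 'rV[R]_n :=
  [set x | [/\ admissible x, pl x <= l, gapped eta x, generic N eta x & recurrent x]].

Section Cell.
Variables (l eta : R) (N : nat) (z : {ffun 'I_n -> int}).
Hypotheses (l01 : 0 < l < 1) (eta0 : 0 < eta).
(** The values of [e] and [h0] are chosen for [5 * e = eta] and [l * e + 2 * h0 = e], where [2 * h0]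
    bounds the variation of the system over a grid cell of side [h0]. *)
Let e := eta / 5.
Let h0 := (1 - l) * e / 2.
Let Q := wild l N eta `&` gridcell h0 z.

Lemma h0_gt0 : 0 < h0.
Proof. by case/andP: l01 => *; rewrite divr_gt0 ?mulr_gt0 ?divr_gt0 ?subr_gt0. Qed.

Lemma cell_cluster m (C : set ('rV[R]_n * R)) : (forall p, C p -> Q p.1) ->
  (forall p q, C p -> C q -> `|p.2 - q.2| <= e) ->
  exists L : seq (seq int), (size L <= 2 ^ m)%N /\
    forall p w, C p -> size w = (m * N)%N -> tracks (xbet p.1) (xgm p.1) p.2 w -> w \in L.
Proof.
case/andP: (l01) => l0 l1; have e0 : 0 < e by rewrite divr_gt0.
have r0 := h0_gt0; have h2E : 2 * h0 = (1 - l) * e by rewrite /h0; field.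
apply: (@few_words R _ (@xbet R k) (@xgm R k) Q l (2 * h0) e eta N).
- by rewrite ltW.
- by rewrite mulr_ge0 // ltW.
- exact: e0.
- by rewrite h2E; lra.
- by rewrite /e; lra.
- by move=> x u [[[xA _] _ _ _ _] _]; apply: bet_cell.
- by move=> x c [[_ _ + _ _] _]; apply.
- move=> x y c [_ xz] [_ yz].
  have [Ha _ _] := coord_near (gridcell_near r0 xz yz).
  apply: le_trans (bet_near c (ltW r0) Ha) _; lra.
- move=> x y c u u' [[[xA x01] xl _ _ _] xz] [[[yA _] _ _ _ _] yz] hu hu'.
  have [Ha Hb Hl] := coord_near (gridcell_near r0 xz yz).
  apply: gm_near hu hu' => //; rewrite xl andbT; case/andP: x01 => *; exact: ltW.
- move=> x c [[_ _ _ g _] _]; have [w sw] := g c false; rewrite addr0 => fw.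
  by exists w.
- by move=> x c [[_ _ _ g _] _]; have [w sw] := g c true; exists w.
Qed.

(** The starting points in [0,1) form [B] clusters of diameter at most [e], with [B] independent of
    [m]. *)
Lemma cell_words : exists B : nat, forall m, exists L : seq (seq int),
  (size L <= B * 2 ^ m)%N /\ forall x u w, Q x -> I01 u -> size w = (m * N)%N ->
     tracks (xbet x) (xgm x) u w -> w \in L.
Proof.
have e0 : 0 < e by rewrite divr_gt0.
exists (Num.trunc e^-1).+1 => m; set B := (Num.trunc e^-1).+1.
have part M : exists L : seq (seq int), (size L <= M * 2 ^ m)%N /\
    forall x u w, Q x -> I01 u -> (Num.trunc (u / e) < M)%N -> size w = (m * N)%N ->
     tracks (xbet x) (xgm x) u w -> w \in L.
  elim: M => [|M [L [sL HL]]]; first by exists [::].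
  have [||L' [sL' HL']] := @cell_cluster m
      [set p | [/\ Q p.1, I01 p.2 & Num.trunc (p.2 / e) = M]].
  - by move=> p [].
  - move=> [x u] [y v] [/= _ /andP[u0 _] uM] [_ /andP[v0 _] vM].
    have u1 : 0 <= u / e by rewrite divr_ge0 // ltW.
    have v1 : 0 <= v / e by rewrite divr_ge0 // ltW.
    have := truncn_itv u1; have := truncn_itv v1.
    rewrite uM vM -natr1 => /andP[v2 v3] /andP[u2 u3].
    have -> : u - v = (u / e - v / e) * e by field; lra.
    rewrite normrM (gtr0_norm e0) -[X in _ <= X]mul1r ler_wpM2r ?(ltW e0) // ler_norml.
    by apply/andP; split; lra.
  exists (L' ++ L); split; first by rewrite size_cat mulSn leq_add.
  move=> x u w Qx u01; rewrite ltnS leq_eqVlt mem_cat => /orP[/eqP uM|uM] sw tw.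
    by rewrite (HL' (x, u)).
  by rewrite (HL x u) ?orbT.
have [L [sL HL]] := part B; exists L; split=> // x u w Qx u01 sw tw.
apply: (HL x u) => //; rewrite ltnS; apply: le_truncn; rewrite -[leRHS]mul1r ler_pM2r ?invr_gt0 //.
by case/andP: u01 => _ /ltW.
Qed.

(** At most [B * 2 ^ m.+1 * 2] slabs, each of volume at most [C * l ^+ (m * N)], cover [Q]. The
    total [4 * B * C * (2 * l ^+ N) ^+ m] tends to 0. *)
Lemma cell_null : 2 * l ^+ N <= 1 / 2 -> null Q.
Proof.
move=> lN; have [B HB] := cell_words.
case/andP: (l01) => l0 l1; have hh := h0_gt0.
apply: (covered_null (n_gt0 k)) => d d0.
pose C : R := (2 * (2 * h0) + 1) ^+ (k + k + 1) * 14 ^+ n.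
have C0 : 0 <= C by rewrite mulr_ge0 ?exprn_ge0 //; lra.
pose D : R := 4 * B%:R * C.
have D0 : 0 <= D by apply: mulr_ge0 => //; apply: mulr_ge0.
have [||m0 Hm0] := @expr_small R (1 / 2) (d / (D + 1)).
- by apply/andP; split; lra.
- by rewrite divr_gt0 //; lra.
pose m := m0.+1.
have Hm : (1 / 2) ^+ m < d / (D + 1).
  apply: le_lt_trans Hm0; rewrite /m exprS ler_piMl ?exprn_ge0 //; lra.
pose h := l ^+ (m * N).
have h_gt0 : 0 < h by rewrite exprn_gt0.
have h1 : h <= 1 by rewrite exprn_ile1 // ltW.
have N0 : (0 < N)%N.
  by rewrite lt0n; apply/eqP => N0; move: lN; rewrite N0 expr0; lra.
(* The words are one block longer than the orbit segment: the letter at position [m * N] names the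
   cell of its endpoint. *)
have [L [sL HL]] := HB m.+1.
pose I := [seq (w, s) | w <- L, s <- [:: false; true]].
pose A (p : seq int * bool) := [set x | Q x /\ exists u, [/\ I01 u,
  ctracks (xbet x) (xgm x) u (take (m * N) p.1) &
  `|endpoint (xgm x) u (take (m * N) p.1)
     - xbet x (nth 0 p.1 (m * N) + p.2%:Z)| <= h]].
have szI w : size w = (m.+1 * N)%N -> size (take (m * N) w) = (m * N)%N.
  by move=> sw; rewrite size_take_min sw; apply/minn_idPl; rewrite leq_mul2r leqnSn orbT.
have sub : Q `<=` [set x | exists2 p, p \in [seq p <- I | size p.1 == (m.+1 * N)%N] & A p x].
  move=> x Qx; have [[xA _ _ _ rec] _] := Qx.
  have [u [w1 [c [u01 sw1 tw1 close]]]] := rec (m * N)%N h h_gt0.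
  have [w2 sw2 tw2] := exists_tracks (xgm x) (fun u => bet_cell u xA.1)
     (endpoint (xgm x) u w1) N.
  have sw : size (w1 ++ w2) = (m.+1 * N)%N by rewrite size_cat sw1 sw2 mulSn addnC.
  have wL : w1 ++ w2 \in L.
    by apply: (HL x u) => //; rewrite tracks_cat tw1.
  have takeE : take (m * N) (w1 ++ w2) = w1 by rewrite -sw1 take_size_cat.
  have nthE : nth 0 (w1 ++ w2) (m * N) = nth 0 w2 0 by rewrite nth_cat sw1 ltnn subnn.
  (* The breakpoint approached may be replaced by an end of the cell containing the endpoint, at
     least as close. So a word leaves only two breakpoints to consider. *)
  have [s hs] : exists s : bool, `|endpoint (xgm x) u w1 - xbet x (nth 0 w2 0 + s%:Z)| <= h.
    case: w2 sw2 tw2 {sw wL takeE nthE} => [|q w2] /=; first by move=> E; rewrite -E in N0.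
    move=> _ /andP[/andP[q1 q2] _]; set v := endpoint _ _ _ in close q1 q2 *.
    rewrite -/(xbet x q) -/(xbet x (q + 1)) in q1 q2.
    case: (lerP c q) => cq.
      exists false; rewrite addr0; have := xbet_le xA cq.
      move: close; rewrite ltr_norml ler_norml => /andP[c1 c2] c3.
      by apply/andP; split; lra.
    exists true; have : xbet x (q + 1) <= xbet x c by apply: xbet_le; rewrite ?lezD1.
    move: close; rewrite ltr_norml ler_norml => /andP[c1 c2] c3.
    by apply/andP; split; lra.
  exists (w1 ++ w2, s).
    rewrite mem_filter /= sw eqxx /=; apply: (@allpairs_f _ _ _ pair) => //.
    by case: s {hs}.
  by split=> //; exists u; rewrite /= takeE nthE; split=> //; apply: tracks_ctracks.
set J := [seq p <- I | _] in sub.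
have covA p : p \in J -> covered_by (A p) ((Num.trunc (2 * (2 * h0) / h)).+1 ^ (k + k + 1)) (7 * h).
  rewrite mem_filter => /andP[/eqP sp _]; apply: (thin_covered (key := @key R k)) => //.
  - lra.
  - move=> x y j [[_ xz] _] [[_ yz] _]; apply: key_near; first exact: ltW.
    exact: gridcell_near xz yz.
  - move=> x y [[[xA xl _ _ _] _] [u [u01 tx ex]]] [[[yA yl _ _ _] _] [v [v01 ty ey]]] kxy.
    have uv : `|u - v| <= 1.
      by case/andP: u01 => *; case/andP: v01 => *; rewrite ler_norml; apply/andP; split; lra.
    have pw x' : admissible x' -> pl x' <= l ->
        pl x' ^+ size (take (m * N) p.1) * `|u - v| <= h.
      move=> [_ /andP[x0 _]] x'l; rewrite (szI _ sp) -[h]mulr1; apply: ler_pM => //.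
        by rewrite exprn_ge0 // ltW.
      by apply: lerXn2r => //; rewrite nnegrE ltW.
    apply: (slab_box xA yA kxy _ (pw _ xA xl) (pw _ yA yl) tx ty ex ey).
    by rewrite (szI _ sp) muln_gt0 /= N0.
have [s [hs cs]] := covered_union covA.
exists (size J * (Num.trunc (2 * (2 * h0) / h)).+1 ^ (k + k + 1))%N, (7 * h); split.
- by rewrite mulr_ge0 // ltW.
- by exists s; split=> // x /sub; apply: cs.
- rewrite natrM -mulrA; apply: (@le_trans _ _ ((size J)%:R * (C * h))).
    by rewrite ler_wpM2l //; apply: thin_volume; rewrite ?h_gt0 //; lra.
  have sJ : (size J <= B * 2 ^ m.+1 * 2)%N.
    rewrite size_filter; apply: leq_trans (count_size _ _) _.
    by rewrite size_allpairs /= leq_mul2r sL orbT.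
  have : (size J)%:R <= B%:R * 2 ^+ m.+1 * 2 :> R by rewrite -natrX -!natrM ler_nat.
  move=> sJ'; apply: le_trans (ler_wpM2r _ sJ') _; first by rewrite mulr_ge0 // ltW.
  have -> : B%:R * 2 ^+ m.+1 * 2 * (C * h) = D * (2 * l ^+ N) ^+ m.
    by rewrite /D /h exprS exprMn -exprM mulnC; ring.
  have : (2 * l ^+ N) ^+ m <= (1 / 2) ^+ m.
    by apply: lerXn2r; rewrite // nnegrE ?mulr_ge0 ?exprn_ge0 //; exact: ltW.
  move=> le1; have le2 : (2 * l ^+ N) ^+ m <= d / (D + 1) by apply: le_trans le1 (ltW Hm).
  apply: le_trans (ler_wpM2l D0 le2) _.
  rewrite mulrA ler_pdivrMr; last lra.
  nra.
Qed.

End Cell.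

Lemma wild_null l N eta : 0 < l < 1 -> 0 < eta -> 2 * l ^+ N <= 1 / 2 -> null (wild l N eta).
Proof.
move=> l01 eta0 lN; apply: (@null_gridcells _ _ ((1 - l) * (eta / 5) / 2)) => z.
exact: cell_null.
Qed.

(** An exceptional parameter has a connection or lies in some set [wild], and countably many sets of
    both kinds suffice. *)
Lemma exceptional_null : null (@exceptional_set R K).
Proof.
(* The slope bounds [1 - 1 / (p + 2)] exhaust (0,1) and the distances [1 / (q + 1)] tend to 0;
   triples with [N] too small for [wild_null] get the empty set. *)
pose W (t : nat * nat * nat) : set 'rV[R]_n :=
  let: (p, N, q) := t in let l := 1 - (p.+2%:R)^-1 in
  if 2 * l ^+ N <= 1 / 2 then wild l N (q.+1%:R^-1) else set0.
pose H (t : int * bool * seq int * int) : set 'rV[R]_n :=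
  let: (c, s, w, c') := t in connection c s w c'.
have nW t : null (W t).
  case: t => [[p N] q]; rewrite /W; case: ifP => [lN|_].
    have p2 : 1 < p.+2%:R :> R by rewrite ltr1n.
    apply: wild_null => //.
    by rewrite subr_gt0 gtrBl invr_gt0 invf_lt1 ?ltr0Sn ?p2.
  move=> e e0; exists (fun=> (0, 0)); split=> [_ i|//|m]; first by rewrite /= mxE.
  by rewrite big1 ?ltW // => i _; rewrite (vol_point _ (n_gt0 k)).
have nH t : null (H t) by case: t => [[[c s] w] c']; apply: connection_null.
pose U (b : bool) := if b then \bigcup_t W t else \bigcup_t H t.
apply: (@null_sub R n _ (\bigcup_b U b)); last first.
  by apply: (null_bigcup (n_gt0 k)) => -[]; apply: (null_bigcup (n_gt0 k)).
move=> x [[[a b] la] [/= aA la01 nAP] xE].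
have [pax pbx plx] : [/\ pa x = a, pb x = b & pl x = la].
  by rewrite -xE /pa /pb /pl !row_mxKl !row_mxKr mxE.
have xA : admissible x by split; rewrite ?pax ?plx.
have rec : recurrent x.
  move=> m e e0; have [u [w [c [u01 sw tw close]]]] := not_periodic_hits m aA la01 e0 nAP.
  by exists u, w, c; rewrite /xbet /xgm pax pbx plx.
have [hit|nohit] := pselect ((\bigcup_t H t) x); first by exists false.
case/andP: (la01) => l0 l1.
pose p := Num.trunc (1 - la)^-1.
have pl1 : la <= 1 - (p.+2%:R)^-1.
  have := truncnS_gt (1 - la)^-1; rewrite -/p -[X in X < _]mul1r ltr_pdivrMr ?subr_gt0 // => h.
  rewrite lerBrDr -lerBrDl -[leLHS]mul1r ler_pdivrMr //.
  have -> : p.+2%:R = p.+1%:R + 1 :> R by rewrite natr1.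
  rewrite mulrDr mulr1; move: h; lra.
have lp : 0 <= 1 - (p.+2%:R : R)^-1 < 1.
  rewrite (le_trans (ltW l0) pl1) /= gtrBl invr_gt0; exact: ltr0Sn.
have [|N HN] := @expr_small R (1 - (p.+2%:R)^-1) (1 / 4) lp; first by lra.
have [|eta [eta0 ge gN]] := @no_connection_generic x N xA.
  by move=> c s w c' Hc; apply: nohit; exists (c, s, w, c').
pose q := Num.trunc eta^-1.
have qe : (q.+1%:R)^-1 <= eta :> R.
  have := truncnS_gt eta^-1; rewrite -/q -[X in X < _]mul1r ltr_pdivrMr // => h.
  by rewrite -[leLHS]mul1r ler_pdivrMr // mulrC ltW.
exists true => //; exists (p, N, q) => //; rewrite /W ifT; last lra.
split=> //; first by rewrite plx.
- by move=> c; apply: le_trans (ge c); rewrite lerD2l.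
- move=> c s; have [w sw fw] := gN c s; exists w => //; exact: far_mono fw.
Qed.

End NullExceptional.

(** * Power series with bounded coefficients *)

Section GeometricSums.
Variables (R : realType) (la : R).
Hypothesis la01 : 0 < la < 1.
Implicit Types (d : nat -> R) (p : R).

(** Convergence with its geometric rate, which every bounded [d] has; sums, shifts and uniqueness
    become inequalities. *)
Definition has_sum d p := exists D, forall r, `|\sum_(j < r) la ^+ j * d j - p| <= D * la ^+ r.

Lemma bounded_has_sum d C : (forall j, `|d j| <= C) -> exists p, has_sum d p.
Proof.
move=> H; case/andP: la01 => l0 l1.
have [|||p Hp] := @geometric_limit R (fun r => \sum_(j < r) la ^+ j * d j) C la.
- by rewrite ltW.
- exact: le_trans (normr_ge0 _) (H 0%N).
- move=> r; rewrite big_ord_recr /= addrAC subrr add0r normrM normrX (gtr0_norm l0) mulrC.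
  by rewrite ler_wpM2r ?exprn_ge0 // ltW.
by exists p, (C / (1 - la)).
Qed.

Lemma le_small x D : (forall r, x <= D * la ^+ r) -> x <= 0.
Proof.
move=> H; case/andP: la01 => l0 l1; rewrite leNgt; apply/negP => x0.
have [||r Hr] := @expr_small R la (x / (`|D| + 1)); first by rewrite ltW.
  by rewrite divr_gt0 // ltr_wpDl.
move: Hr; rewrite ltr_pdivlMr ?ltr_wpDl // => Hr.
have := H r; have := exprn_gt0 r l0; have := ler_norm D; nra.
Qed.

Lemma has_sum_uniq d p p' : has_sum d p -> has_sum d p' -> p = p'.
Proof.
move=> [D H] [D' H']; apply/eqP; rewrite -subr_eq0 -normr_le0.
apply: (@le_small _ (D + D')) => r; rewrite mulrDl.
apply: le_trans (ler_distD (\sum_(j < r) la ^+ j * d j) _ _) _.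
by rewrite lerD // distrC.
Qed.

Lemma has_sumD d d' p p' : has_sum d p -> has_sum d' p' ->
  has_sum (fun j => d j + d' j) (p + p').
Proof.
move=> [D H] [D' H']; exists (D + D') => r.
rewrite (eq_bigr (fun j : 'I_r => la ^+ j * d j + la ^+ j * d' j)); last by move=> j _; rewrite mulrDr.
rewrite big_split /= opprD addrACA [leRHS]mulrDl.
by apply: le_trans (ler_normD _ _) _; apply: lerD; [exact: H|exact: H'].
Qed.

Lemma has_sumN d p : has_sum d p -> has_sum (fun j => - d j) (- p).
Proof.
move=> [D H]; exists D => r.
rewrite (eq_bigr (fun j : 'I_r => - (la ^+ j * d j))); last by move=> j _; rewrite mulrN.
by rewrite sumrN -opprD normrN; exact: H.
Qed.

Lemma has_sumS d p : has_sum (fun j => d j.+1) p -> has_sum d (d 0%N + la * p).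
Proof.
move=> [D H]; case/andP: la01 => l0 l1; exists (`|D| + `|d 0%N + la * p|) => -[|r].
  by rewrite big_ord0 sub0r normrN expr0 mulr1 lerDr.
rewrite big_ord_recl expr0 mul1r opprD addrACA subrr add0r.
under eq_bigr do rewrite /= /bump leq0n add1n exprS -mulrA.
rewrite -mulr_sumr -mulrBr normrM (gtr0_norm l0) mulrDl.
rewrite -[leLHS]addr0; apply: lerD; last by rewrite mulr_ge0 // exprn_ge0 // ltW.
rewrite exprS mulrCA ler_wpM2l ?(ltW l0) //; apply: le_trans (H r) _.
by rewrite ler_wpM2r ?ler_norm // exprn_ge0 // ltW.
Qed.

(** A constant series is its own shift, so its sum satisfies [p = c + la * p]. *)
Lemma has_sum_const c : has_sum (fun=> c) (c / (1 - la)).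
Proof.
case/andP: la01 => l0 l1.
have [|p Hp] := @bounded_has_sum (fun=> c) `|c|; first by [].
have := has_sum_uniq Hp (has_sumS Hp) => pE.
suff -> : c / (1 - la) = p by [].
have -> : c = p * (1 - la) by lra.
by field; lra.
Qed.

Lemma partial_le_sum d p r : (forall j, 0 <= d j) -> has_sum d p ->
  \sum_(j < r) la ^+ j * d j <= p.
Proof.
move=> d0 [D H]; case/andP: la01 => l0 l1; rewrite -subr_le0.
have mono m : \sum_(j < r) la ^+ j * d j <= \sum_(j < r + m) la ^+ j * d j.
  elim: m => [|m IH]; first by rewrite addn0.
  by rewrite addnS big_ord_recr /= (le_trans IH) // lerDl mulr_ge0 // exprn_ge0 // ltW.
apply: (@le_small _ (D * la ^+ r)) => m.
rewrite -mulrA -exprD; have := H (r + m)%N; have := mono m.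
by rewrite ler_norml => h1 /andP[_ h2]; lra.
Qed.

End GeometricSums.

(** * A contracted rotation of irrational rotation number *)

Section Rotation.
Variable R : realType.

(** Chosen for [rho ^+ 2 = 1 - 2 * rho]: powers of [rho] are explicit integer combinations of 1 and
    [rho]. *)
Definition rho : R := Num.sqrt 2 - 1.

Lemma rho_sqr : rho ^+ 2 = 1 - 2 * rho.
Proof. by rewrite /rho sqrrB sqr_sqrtr //; ring. Qed.

Lemma rho_itv : 0 < rho < 1.
Proof.
have s : Num.sqrt 2 ^+ 2 = 2 :> R by rewrite sqr_sqrtr.
have s0 : 0 <= Num.sqrt 2 :> R by rewrite sqrtr_ge0.
rewrite /rho; apply/andP; split; nra.
Qed.

(** The equation would give [(m + q) ^ 2 = 2 * q ^ 2], where 2 has even exponent on the left and odd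
    exponent on the right. *)
Lemma rho_irrational (m : int) q : (0 < q)%N -> m%:~R = q%:R * rho -> False.
Proof.
move=> q0 E.
have : ((m + q%:Z) ^+ 2)%:~R = (2 * q%:Z ^+ 2)%:~R :> R.
  rewrite rmorphXn rmorphM rmorphXn /= intrD E /rho; set s := Num.sqrt _.
  have s2 : s ^+ 2 = 2 by rewrite sqr_sqrtr.
  have -> : q%:R * (s - 1) + q%:~R = q%:R * s by rewrite -[q%:~R]/(q%:R); ring.
  by rewrite exprMn s2 mulrC.
move=> /eqP; rewrite eqr_int => /eqP /(congr1 (fun z : int => `|z|%N)).
rewrite abszX abszM abszX /= => H.
have : logn 2 (`|(m + q%:Z)%R| ^ 2) = logn 2 (2 * q ^ 2) by rewrite H.
rewrite lognX lognM ?expn_gt0 ?q0 // lognX (_ : logn 2 2 = 1%N) //; lia.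
Qed.

(* The even powers of [rho] are fractional parts of multiples of [- rho]. *)
Lemma rho_approx e : 0 < e -> exists p q : nat, (0 < q)%N /\ 0 < p%:R - q%:R * rho < e.
Proof.
move=> e0; have /andP[r0 r1] := rho_itv; have r2 := rho_sqr.
have pow i : exists p q : nat, (0 < q)%N /\ p%:R - q%:R * rho = (rho ^+ 2) ^+ i.+1.
  elim: i => [|i [p [q [q0 IH]]]].
    by exists 1%N, 2%N; split=> //; rewrite expr1 r2.
  exists (p + 2 * q)%N, (2 * p + 5 * q)%N; split; first by lia.
  have -> : (p + 2 * q)%:R = p%:R + 2 * q%:R :> R by rewrite natrD natrM.
  have -> : (2 * p + 5 * q)%:R = 2 * p%:R + 5 * q%:R :> R by rewrite natrD !natrM.
  rewrite exprSr -IH r2.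
  have -> : (p%:R - q%:R * rho) * (1 - 2 * rho) =
     p%:R - 2 * p%:R * rho - q%:R * rho + 2 * q%:R * rho ^+ 2 by ring.
  by rewrite r2; ring.
have [|i Hi] := @expr_small R (rho ^+ 2) e _ e0.
  by rewrite exprn_ge0 ?exprn_ilt1 // ltW.
have [p [q [q0 E]]] := pow i; exists p, q; split=> //.
rewrite E !exprn_gt0 //=; apply: le_lt_trans Hi.
by rewrite exprS ler_piMl ?exprn_ge0 ?exprn_ile1 // ltW.
Qed.

Lemma floor_add_ge (x y : R) : (Num.floor x)%:~R + (Num.floor y)%:~R <= (Num.floor (x + y))%:~R :> R.
Proof.
rewrite -intrD ler_int floor_ge_int intrD.
have := floor_itv x; have := floor_itv y; rewrite !intrD => /andP[h1 h2] /andP[h3 h4]; lra.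
Qed.

Lemma floor_add_le (x y : R) : (Num.floor (x + y))%:~R <= (Num.floor x)%:~R + (Num.floor y)%:~R + 1 :> R.
Proof.
rewrite -[1]/(1%:~R) -!intrD ler_int -ltzD1 -(ltr_int R) !intrD.
have := floor_itv x; have := floor_itv y; have := floor_itv (x + y).
by rewrite !intrD => /andP[h1 h2] /andP[h3 h4] /andP[h5 h6]; lra.
Qed.

Lemma floor_add_carry (x y : R) : (x - (Num.floor x)%:~R) + (y - (Num.floor y)%:~R) < 1 ->
  (Num.floor (x + y))%:~R = (Num.floor x)%:~R + (Num.floor y)%:~R :> R.
Proof.
move=> h; rewrite -intrD; congr (_%:~R); apply: floor_def; rewrite !intrD.
have := floor_itv x; have := floor_itv y; rewrite !intrD => /andP[h1 h2] /andP[h3 h4].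
by apply/andP; split; lra.
Qed.

Variable la : R.
Hypothesis la01 : 0 < la < 1.

Let fl (x : R) : R := (Num.floor x)%:~R.
Let d (y : R) (j : nat) : R := fl (y - j.+1%:R * rho) - fl (- (j.+1%:R * rho)).

Lemma d_bounds y j : fl y <= d y j <= fl y + 1.
Proof.
have := floor_add_ge y (- (j.+1%:R * rho)); have := floor_add_le y (- (j.+1%:R * rho)).
by rewrite /d /fl => h1 h2; apply/andP; split; lra.
Qed.

(** Some multiple of [- rho] has a fractional part below [1 - (y - fl y)], so adding it to [y]
    produces no carry. *)
Lemma d_carry y : exists j, d y j = fl y.
Proof.
have /andP[y1 y2] := floor_itv y; rewrite intrD in y2.
have [|p [q [q0 /andP[h1 h2]]]] := @rho_approx (1 - (y - fl y)).
  by rewrite /fl; lra.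
exists q.-1; rewrite /d prednK // /fl floor_add_carry ?addrK //.
have -> : Num.floor (- (q%:R * rho)) = - p%:Z.
  apply: floor_def; rewrite intrD intrN -[p%:~R]/(p%:R).
  by move: h2; rewrite /fl => h2; apply/andP; split; lra.
by move: h2; rewrite /fl intrN -[p%:~R]/(p%:R) => h2; lra.
Qed.

Lemma d_sum y : exists p, has_sum la (d y) p.
Proof.
apply: (@bounded_has_sum _ _ la01 _ (`|fl y| + 1)) => j.
have /andP[h1 h2] := d_bounds y j; have := ler_norm (fl y); have := ler_norm (- fl y).
by rewrite normrN ler_norml => h3 h4; apply/andP; split; lra.
Qed.

Let Sd y : R := projT1 (cid (d_sum y)).
Let SdP y : has_sum la (d y) (Sd y).
Proof. by rewrite /Sd; case: cid. Qed.

(* The classical series [(1 - la) \sum_j la^j (floor (y - (j+1) rho) - floor (- (j+1) rho))];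
   subtracting the value at [0] makes the terms bounded. *)
Definition conjugacy y : R := (1 - la) * Sd y.

Lemma conjugacy0 : conjugacy 0 = 0.
Proof.
rewrite /conjugacy (_ : Sd 0 = 0) ?mulr0 //.
apply: (has_sum_uniq la01 (SdP 0)); exists 0 => r.
rewrite big1 ?subrr ?normr0 ?mul0r // => j _.
by rewrite /d sub0r subrr mulr0.
Qed.

(** [conjugacy y] is the average of the [d y j] with weights [(1 - la) * la ^+ j] of sum 1. The
    upper bound is strict because [d_carry] gives a term below it. *)
Lemma conjugacy_floor y : fl y <= conjugacy y < fl y + 1.
Proof.
case/andP: (la01) => l0 l1.
have hc := has_sum_const la01 (fl y).
have hc1 := has_sum_const la01 (fl y + 1).
have up := has_sumD (SdP y) (has_sumN hc).
have dn := has_sumD hc1 (has_sumN (SdP y)).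
rewrite /conjugacy.
have u0 : 0 <= Sd y - fl y / (1 - la).
  have := partial_le_sum la01 0 _ up; rewrite big_ord0; apply => j.
  by have /andP[h1 _] := d_bounds y j; lra.
have [j0 hj0] := d_carry y.
have u1 : la ^+ j0 <= (fl y + 1) / (1 - la) - Sd y.
  have nn j : 0 <= fl y + 1 - d y j by have /andP[_ h1] := d_bounds y j; lra.
  apply: le_trans (partial_le_sum la01 j0.+1 nn dn).
  rewrite big_ord_recr /= hj0 addrAC subrr add0r mulr1 lerDr.
  by apply: sumr_ge0 => j _; rewrite mulr_ge0 // exprn_ge0 // ltW.
have p0 : 0 < la ^+ j0 by rewrite exprn_gt0.
have l2 : 0 < 1 - la by lra.
apply/andP; split.
  by rewrite mulrC -ler_pdivrMr //; lra.
by rewrite mulrC -ltr_pdivlMr //; lra.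
Qed.

(** Adding [rho] to [y] shifts the index of the series by one, up to the correction [g] that does
    not depend on [y]; the sum of [g] goes into [b]. *)
Lemma conjugacy_step : exists b, forall y,
  conjugacy (y + rho) = la * (conjugacy y - fl y) + b + fl y.
Proof.
pose g j : R := fl (- (j.+1%:R * rho)) - fl (- (j.+2%:R * rho)).
have /andP[r0 r1] := rho_itv.
have gE j : (- (j.+1%:R * rho)) = - (j.+2%:R * rho) + rho by rewrite -[j.+2%:R]natr1; ring.
have flr : fl rho = 0 by rewrite /fl (@floor_def _ rho 0) // ltW.
have [|T hT] := @bounded_has_sum _ _ la01 g 1.
  move=> j; rewrite /g gE.
  have := floor_add_ge (- (j.+2%:R * rho)) rho; have := floor_add_le (- (j.+2%:R * rho)) rho.
  rewrite -!/(fl _) flr addr0 => h1 h2.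
  by rewrite ler_norml; apply/andP; split; lra.
exists ((1 - la) * (1 + la * T)) => y.
have h1 := has_sumD (SdP y) hT.
have E j : d y j + g j = d (y + rho) j.+1.
  rewrite /d /g; have -> : y + rho - j.+2%:R * rho = y - j.+1%:R * rho.
    by rewrite -[j.+2%:R]natr1; ring.
  ring.
have h2 : has_sum la (fun j => d (y + rho) j.+1) (Sd y + T).
  by move: h1; rewrite (_ : (fun j => d y j + g j) = fun j => d (y + rho) j.+1) //; apply/funext.
have := has_sum_uniq la01 (SdP (y + rho)) (has_sumS la01 h2).
have -> : d (y + rho) 0%N = fl y + 1.
  rewrite /d mul1r addrK; have -> : fl (- rho) = -1; last by rewrite opprK.
  by rewrite /fl (@floor_def _ (- rho) (-1)) ?intrN // ; apply/andP; split; rewrite ?intrD ?intrN; lra.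
rewrite /conjugacy => ->; ring.
Qed.

End Rotation.

(** * Equal intercepts give maps without periodic points *)

Section EqualIntercepts.
Variables (R : realType) (la b : R).
Hypothesis la01 : 0 < la < 1.

Definition rotation_lift (u : R) : R := la * (u - (Num.floor u)%:~R) + b + (Num.floor u)%:~R.

(** The lift increases between integers and jumps up by [1 - la] at each integer. *)
Lemma rotation_lift_mono u u' : u <= u' -> rotation_lift u <= rotation_lift u'.
Proof.
case/andP: la01 => l0 l1 uu'.
have := floor_itv u; have := floor_itv u'; rewrite !intrD => /andP[h1 h2] /andP[h3 h4].
have : Num.floor u <= Num.floor u' by apply: le_floor.
rewrite le_eqVlt => /orP[/eqP E|]; rewrite /rotation_lift.
  by rewrite -E lerD2r lerD2r ler_pM2l // lerD2r.
rewrite -lezD1 -(ler_int R) intrD => h5.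
have : la * (u - (Num.floor u)%:~R) <= 1 by nra.
have : 0 <= la * (u' - (Num.floor u')%:~R) by rewrite mulr_ge0 ?(ltW l0) // subr_ge0.
lra.
Qed.

Lemma rotation_liftD u (m : int) : rotation_lift (u + m%:~R) = rotation_lift u + m%:~R.
Proof.
have E : Num.floor (u + m%:~R) = Num.floor u + m.
  apply: floor_def; have := floor_itv u; rewrite !intrD => /andP[h1 h2].
  by apply/andP; split; lra.
by rewrite /rotation_lift E intrD; ring.
Qed.

Lemma iter_rotation_liftD n u (m : int) :
  iter n rotation_lift (u + m%:~R) = iter n rotation_lift u + m%:~R.
Proof. by elim: n => //= n ->; rewrite rotation_liftD. Qed.

Lemma iter_rotation_lift_mono n u u' : u <= u' ->
  iter n rotation_lift u <= iter n rotation_lift u'.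
Proof. by move=> h; elim: n => //= n; apply: rotation_lift_mono. Qed.

Lemma fabl_rotation k (a : 'rV[R]_k) u : @Aset R k.+1 a ->
  @fabl R k.+1 a (const_mx b) la (frac u) = frac (rotation_lift u).
Proof.
move=> aA; have [i iK hi] := al_cell aA (frac_itv u).
rewrite /fabl -/(frac _) (Fabl_cell _ la aA iK hi) mxE /rotation_lift /frac.
set t := la * _ + b.
have -> : Num.floor (t + (Num.floor u)%:~R) = Num.floor t + Num.floor u.
  apply: floor_def; have := floor_itv t; rewrite !intrD => /andP[h1 h2].
  by apply/andP; split; lra.
by rewrite intrD; ring.
Qed.

Lemma iter_fabl_rotation k (a : 'rV[R]_k) u n : @Aset R k.+1 a ->
  iter n (@fabl R k.+1 a (const_mx b) la) (frac u) = frac (iter n rotation_lift u).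
Proof. by move=> aA; elim: n => //= n ->; rewrite fabl_rotation. Qed.

End EqualIntercepts.

(* For a suitable common intercept, the lift carries the orbit of [0] along the irrational
   rotation by [rho], which rules out periodic points. *)
Lemma equal_intercepts_not_periodic (R : realType) (la : R) : 0 < la < 1 ->
  exists b, forall k (a : 'rV[R]_k), @Aset R k.+1 a ->
    ~ asymptotically_periodic (@fabl R k.+1 a (const_mx b) la).
Proof.
move=> la01; have [b Hb] := conjugacy_step la01; exists b => k a aA [AP _].
have [|p [q [p01 q0 fp _]]] := AP 0; first by rewrite /I01 /= lexx ltr01.
set f := fabl _ _ _ in fp; pose F := rotation_lift la b.
pose v n := conjugacy la01 (n%:R * rho R).
have vE n : iter n F 0 = v n.
  elim: n => [|n IH]; first by rewrite /v mul0r conjugacy0.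
  rewrite /= IH /v -natr1 mulrDl mul1r Hb /F /rotation_lift.
  have -> : Num.floor (conjugacy la01 (n%:R * rho R)) = Num.floor (n%:R * rho R).
    by apply: floor_def; rewrite intrD; apply: conjugacy_floor.
  by [].
have vb n : n%:R * rho R - 1 <= v n <= n%:R * rho R + 1.
  have /andP[h1 h2] := conjugacy_floor la01 (n%:R * rho R).
  have := floor_itv (n%:R * rho R); rewrite intrD => /andP[h3 h4].
  by rewrite /v; apply/andP; split; lra.
pose m := Num.floor (iter q F p).
have Fp : iter q F p = p + m%:~R.
  have := iter_fabl_rotation la b p q aA; rewrite (frac_id p01) -/f fp /frac -/F -/m => h.
  by rewrite {2}h; ring.
have Frp r : iter (r * q) F p = p + (m *+ r)%:~R.
  elim: r => [|r IH]; first by rewrite mulr0n addr0.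
  by rewrite mulSn iterD IH (iter_rotation_liftD la b) -/F Fp mulrS intrD addrA.
(* A periodic point [p] moves by [m] in [q] steps of the lift. Its orbit stays between those of 0
   and 1, which advance by [rho] per step up to a bounded error; as [r] grows this forces
   [m = q * rho]. *)
have bound r : `|r%:R * (m%:~R - q%:R * rho R)| <= 3.
  case/andP: (p01) => p0 p1.
  have h1 := iter_rotation_lift_mono b la01 (r * q) p0.
  have h2 := iter_rotation_lift_mono b la01 (r * q) (ltW p1).
  have := iter_rotation_liftD la b (r * q) 0 1; rewrite add0r => h3; rewrite h3 in h2.
  rewrite -/F Frp vE in h1 h2.
  have /andP[h4 h5] := vb (r * q)%N.
  have E : (m *+ r)%:~R = r%:R * m%:~R :> R by rewrite rmorphMn /= mulr_natl.
  rewrite E natrM in h1 h2 h4 h5.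
  rewrite ler_norml mulrBr mulrA; apply/andP; split; lra.
have : m%:~R - q%:R * rho R = 0.
  apply/eqP; rewrite -normr_eq0 eq_le normr_ge0 andbT leNgt; apply/negP => d0.
  have := bound (Num.trunc (3 / `|m%:~R - q%:R * rho R|)).+1.
  rewrite normrM normr_nat leNgt => /negP; apply.
  by rewrite -ltr_pdivrMr // truncnS_gt.
by move=> /eqP; rewrite subr_eq0 => /eqP; apply: rho_irrational.
Qed.

(** * Covers of a cube by sup-norm balls *)

Section CubeCovers.
Variables (R : realType) (k : nat).
Local Notation K := k.+1.

Lemma spread_count N M (S : {pred 'I_N}) :
  (forall i j : 'I_N, i \in S -> j \in S -> (j < i + M)%N) -> (#|S| <= M)%N.
Proof.
move=> H; have [/pred0P /eq_card0 -> //|/existsP[i0 i0S]] := boolP (pred0b S).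
have [i iS imin] := arg_minnP (fun i : 'I_N => i : nat) i0S.
rewrite cardE -(size_map val) -(size_iota i M); apply: uniq_leq_size.
  by rewrite map_inj_uniq ?enum_uniq //; apply: val_inj.
move=> _ /mapP[j jS ->]; rewrite mem_enum in jS.
by rewrite mem_iota imin //= H.
Qed.

Lemma grid_cube_count N (c rad lo sg : R) : (0 < N)%N -> 0 < sg -> 0 < rad ->
  (#|[pred i : 'I_N | (`|lo + sg * (i%:R / N%:R) - c| < rad)%R]|
     <= (Num.trunc (2 * rad * N%:R / sg)).+1)%N.
Proof.
move=> N0 sg0 rad0; apply: spread_count => i j; rewrite !inE !ltr_norml.
move=> /andP[i1 i2] /andP[j1 j2].
have N1 : 0 < N%:R :> R by rewrite ltr0n.
have h : sg * ((j%:R - i%:R) / N%:R) < 2 * rad by rewrite mulrBl mulrBr; lra.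
have h2 : j%:R - i%:R < 2 * rad * N%:R / sg.
  by rewrite ltr_pdivlMr // -ltr_pdivrMr // mulrAC mulrC.
case: (leqP j i) => ji; first by rewrite addnS ltnS (leq_trans ji) // leq_addr.
rewrite addnS ltnS -leq_subLR truncn_ge_nat; last by rewrite !mulr_ge0 ?invr_ge0 // ltW.
by rewrite natrB; [exact: ltW | exact: ltnW].
Qed.

(* Counting the points of a fine grid in the cube. *)
Lemma finite_ball_cover (lo : 'I_K -> R) (sg : R) m (c : nat -> 'rV[R]_K) (rad : nat -> R) :
  0 < sg -> (forall j, 0 < rad j) ->
  (forall t : 'rV[R]_K, (forall i, lo i <= t 0 i <= lo i + sg) ->
     exists2 j, (j < m)%N & forall i, `|t 0 i - c j 0 i| < rad j) ->
  1 <= (4 / sg) ^+ K * \sum_(j < m) rad j ^+ K.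
Proof.
move=> sg0 rad0 cov.
(* The grid is finer than every ball, so that rounding up at most doubles the count
   [2 * rad j * N / sg] per coordinate; hence the factor 4. *)
have [N N0 HN] : exists2 N, (0 < N)%N & forall j, (j < m)%N -> sg <= 2 * rad j * N%:R.
  elim: m {cov} => [|m [N N0 HN]]; first by exists 1%N.
  exists (maxn N (Num.trunc (sg / (2 * rad m))).+1); first by rewrite leq_max N0.
  move=> j; rewrite ltnS leq_eqVlt => /orP[/eqP->|/HN h].
    rewrite mulrC -ler_pdivrMr ?mulr_gt0 //.
    apply: le_trans (ltW (truncnS_gt _)) _; by rewrite ler_nat leq_maxr.
  apply: le_trans h _; rewrite ler_wpM2l ?mulr_ge0 ?(ltW (rad0 j)) //.
  by rewrite ler_nat leq_maxl.
have N1 : 0 < N%:R :> R by rewrite ltr0n.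
pose pt (f : {ffun 'I_K -> 'I_N}) : 'rV[R]_K := \row_i (lo i + sg * ((f i)%:R / N%:R)).
have ptin f i : lo i <= pt f 0 i <= lo i + sg.
  rewrite mxE lerDl lerD2l mulr_ge0 ?(ltW sg0) ?divr_ge0 //=.
  by rewrite ler_piMr ?(ltW sg0) // ler_pdivrMr // mul1r ler_nat ltnW.
pose B (j : 'I_m) := [pred f | [forall i, `|pt f 0 i - c j 0 i| < rad j]].
have cardB j : (#|B j| <= (Num.trunc (2 * rad j * N%:R / sg)).+1 ^ K)%N.
  pose F i := [pred x : 'I_N | (`|lo i + sg * (x%:R / N%:R) - c j 0 i| < rad j)%R].
  apply: (@leq_trans #|family (fun i => F i)|).
    apply: subset_leq_card; apply/fintype.subsetP => f; rewrite inE => /forallP h.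
    by apply/familyP => i; have := h i; rewrite mxE inE.
  rewrite card_family foldrE big_map big_enum /=.
  rewrite (_ : (_ ^ K)%N = (\prod_(i in 'I_K) (Num.trunc (2 * rad j * N%:R / sg)).+1)%N); last first.
    by rewrite prod_nat_const card_ord.
  by apply: leq_prod => i _; apply: grid_cube_count.
have total : (N ^ K <= \sum_(j < m) #|B j|)%N.
  have -> : (N ^ K = #|{ffun 'I_K -> 'I_N}|)%N by rewrite card_ffun !card_ord.
  rewrite -sum1_card (eq_bigr (fun j : 'I_m => \sum_(f in {ffun 'I_K -> 'I_N}) (f \in B j : nat))%N).
    rewrite exchange_big /=; apply: leq_sum => f _.
    have [j jm hj] := cov _ (ptin f).
    rewrite (bigD1 (Ordinal jm)) //= (_ : (f \in B (Ordinal jm)) = true) //.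
    by rewrite inE; apply/forallP => i; apply: hj.
  by move=> j _; rewrite -sum1_card big_mkcond; apply: eq_bigr => f _; case: (f \in B j).
have step (j : 'I_m) : #|B j|%:R <= (4 / sg) ^+ K * rad j ^+ K * N%:R ^+ K :> R.
  rewrite -!exprMn; apply: (@le_trans _ _ (((Num.trunc (2 * rad j * N%:R / sg)).+1 ^ K)%:R)).
    by rewrite ler_nat.
  rewrite natrX; apply: lerXn2r; rewrite ?nnegrE //.
    by rewrite !mulr_ge0 ?invr_ge0 ?(ltW sg0) ?(ltW (rad0 _)).
  have q0 : 0 <= 2 * rad j * N%:R / sg by rewrite !mulr_ge0 ?invr_ge0 ?(ltW sg0) ?(ltW (rad0 _)).
  have /andP[h1 _] := truncn_itv q0.
  have h2 : 1 <= 2 * rad j * N%:R / sg by rewrite ler_pdivlMr // mul1r HN.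
  have -> : 4 / sg * rad j * N%:R = 2 * (2 * rad j * N%:R / sg) by ring.
  by rewrite -natr1; move: h1 h2; lra.
have NK : 0 < N%:R ^+ K :> R by rewrite exprn_gt0.
rewrite -(ler_pM2r NK) mul1r mulr_sumr mulr_suml -natrX.
apply: (@le_trans _ _ (\sum_(j < m) #|B j|%:R)).
  by rewrite -natr_sum ler_nat.
by rewrite natrX; apply: ler_sum => j _.
Qed.

(** The cube is compact and the balls are open, so finitely many suffice. *)
Lemma ball_cover (lo : 'I_K -> R) (sg : R) (c : nat -> 'rV[R]_K) (rad : nat -> R) :
  0 < sg -> (forall j, 0 < rad j) ->
  (forall t : 'rV[R]_K, (forall i, lo i <= t 0 i <= lo i + sg) ->
     exists j, forall i, `|t 0 i - c j 0 i| < rad j) ->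
  exists m, 1 <= (4 / sg) ^+ K * \sum_(j < m) rad j ^+ K.
Proof.
move=> sg0 rad0 cov.
pose seg i : set R := [set` `[lo i, lo i + sg]].
have cpt : compact [set t : 'rV[R]_K | forall i, seg i (t ord0 i)].
  by apply: rV_compact => i; apply: segment_compact.
rewrite compact_cover in cpt.
have [||D _ HD] := cpt nat setT (fun j => ball (c j) (rad j)).
- by move=> j _; apply: ball_open.
- move=> t ht; have [|j hj] := cov t; first by move=> i; have := ht i; rewrite /seg /= in_itv.
  exists j => //; split=> // i' i; rewrite ord1; rewrite /ball /= distrC; exact: hj.
exists (\max_(j <- finmap.enum_fset D) j).+1; apply: (finite_ball_cover (c := c) sg0 rad0) => t ht.
have [|j jD [_ hj]] := HD t; first by move=> i; rewrite /seg /= in_itv; apply: ht.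
exists j; first by rewrite ltnS; apply: (@leq_bigmax_seq _ _ xpredT id).
by move=> i; have := hj 0 i; rewrite /ball /= distrC.
Qed.

End CubeCovers.

(** * Lower bound for the Hausdorff dimension *)

Section HausdorffLowerBound.
Variables (R : realType) (n k : nat).
Local Notation K := k.+1.
Implicit Types (U E : set 'rV[R]_n).

Lemma diam_ge0 U : (0 <= diam U)%E.
Proof. by apply: ereal_sup_ubound; left. Qed.

Lemma dist_le_diam U x y : U x -> U y -> ((euclidean_dist x y)%:E <= diam U)%E.
Proof. by move=> Ux Uy; apply: ereal_sup_ubound; right; exists (x, y). Qed.

Lemma coord_le_dist (x y : 'rV[R]_n) i : `|x 0 i - y 0 i| <= euclidean_dist x y.
Proof.
rewrite -sqrtr_sqr /euclidean_dist ler_sqrt; last first.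
  by apply: sumr_ge0 => j _; apply: sqr_ge0.
rewrite (bigD1 i) //= lerDl; apply: sumr_ge0 => j _; exact: sqr_ge0.
Qed.

Lemma diam_pow_ge0 s U : (0 <= diam_pow s U)%E.
Proof. by rewrite /diam_pow; case: ifP => // _; apply: poweR_ge0. Qed.

Lemma expr_le_diam_pow s U (d : R) : 0 <= s < K%:R -> diam U = d%:E -> d <= 1 ->
  U !=set0 -> ((d ^+ K)%:E <= diam_pow s U)%E.
Proof.
move=> /andP[s0 sK] dE d1 U0.
have d0 : 0 <= d by rewrite -lee_fin -dE diam_ge0.
rewrite /diam_pow ifF; last by apply/negbTE/set0P.
rewrite dE poweR_EFin lee_fin.
move: d0; rewrite le_eqVlt => /orP[/eqP <-|d0]; first by rewrite expr0n powR_ge0.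
by rewrite -powR_mulrn ?(ltW d0) //; apply: ger_powR (ltW sK); rewrite d0.
Qed.

Lemma exprD_le (a b : R) : 0 <= a -> 0 <= b -> (a + b) ^+ K <= 2 ^+ K * (a ^+ K + b ^+ K).
Proof.
move=> a0 b0; have aK : 0 <= a ^+ K by rewrite exprn_ge0.
have bK : 0 <= b ^+ K by rewrite exprn_ge0.
have [ab|ba] := leP a b.
  apply: (@le_trans _ _ ((2 * b) ^+ K)); first by apply: lerXn2r; rewrite ?nnegrE; lra.
  by rewrite exprMn ler_wpM2l ?exprn_ge0 // lerDr.
apply: (@le_trans _ _ ((2 * a) ^+ K)); first by apply: lerXn2r; rewrite ?nnegrE; lra.
by rewrite exprMn ler_wpM2l ?exprn_ge0 // lerDl.
Qed.

(** If the [s]-dimensional measure vanished for some [s < K], then [E] would have covers by sets of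
    diameter at most 1 with small sum of [s]-th, hence of [K]-th, powers of the diameters.
    Projected, they would cover the cube by balls of too small total volume. *)
Lemma hausdorff_dim_ge E (pr : 'rV[R]_n -> 'rV[R]_K) (lo : 'I_K -> R) (sg : R) : 0 < sg ->
  (forall x y i, `|pr x 0 i - pr y 0 i| <= euclidean_dist x y) ->
  (forall t : 'rV[R]_K, (forall i, lo i <= t 0 i <= lo i + sg) -> exists2 x, E x & pr x = t) ->
  (K%:R%:E <= hausdorff_dim E)%E.
Proof.
move=> sg0 lip cube; apply: le_ereal_inf_tmp => _ [s [s0 Hs] <-].
rewrite lee_fin leNgt; apply/negP => sK.
pose C : R := (4 / sg) ^+ K * 2 ^+ K * 2.
have C0 : 0 < C by rewrite !mulr_gt0 ?exprn_gt0 ?divr_gt0.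
(* Chosen so that [C * e < 1]. In [C], the factor [2 ^+ K] comes from [exprD_le] and the last 2 from
   the two sums bounded by [e]. *)
pose e := (C + 1)^-1.
have e0 : 0 < e by rewrite invr_gt0; lra.
have e1 : e <= 1 by rewrite invf_le1; lra.
have : (hausdorff_premeasure s 1 E < e%:E)%E.
  apply: (@le_lt_trans _ _ 0%E); last by rewrite lte_fin.
  by rewrite -Hs; apply: ereal_sup_ubound; exists 1 => //=.
move=> /ereal_inf_lt[_ [U [EU dU] <-] sumU].
pose d j := fine (diam (U j)).
have dE j : diam (U j) = (d j)%:E.
  rewrite /d fineK // fin_numElt; apply/andP; split.
    exact: lt_le_trans (ltNyr 0) (diam_ge0 _).
  exact: le_lt_trans (dU j) (ltry _).
have d1 j : d j <= 1 by rewrite -lee_fin -dE.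
have d0 j : 0 <= d j by rewrite -lee_fin -dE diam_ge0.
have dK j : ((d j ^+ K)%:E <= diam_pow s (U j))%E.
  have [U0|/set0P U0] := eqVneq (U j) set0; last first.
    by apply: expr_le_diam_pow => //; rewrite s0.
  suff -> : d j = 0 by rewrite expr0n diam_pow_ge0.
  rewrite /d U0 /diam (_ : [set _ | _ in _] = set0) ?setU0 ?ereal_sup1 //.
  by rewrite -subset0 => z [[x y] [/= []]].
(* A summable enlargement, which makes the radii positive even where the diameter is 0 and lets open
   balls contain the projected sets. *)
pose eta j := e / 2 ^+ j.+1.
have eta0 j : 0 < eta j by rewrite divr_gt0 // exprn_gt0.
have eta1 j : eta j <= 1.
  rewrite ler_pdivrMr ?exprn_gt0 // mul1r; apply: le_trans e1 _.
  by rewrite exprn_ege1 // ler1n.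
pose rad j := d j + eta j.
have rad0 j : 0 < rad j by rewrite ltr_wpDl.
(* The default 0 serves only for empty [U j], which cover nothing. *)
pose c j := pr (xget 0 (U j)).
have [|m] := @ball_cover R k lo sg c rad sg0 rad0.
  move=> t /cube[x Ex <-]; have [j _ Ujx] := EU _ Ex; exists j => i.
  apply: le_lt_trans (lip _ _ _) _; apply: (@le_lt_trans _ _ (d j)); last by rewrite ltrDl.
  by rewrite -lee_fin -dE; apply: dist_le_diam => //; apply: xgetPex; exists x.
have sum_d : \sum_(j < m) d j ^+ K <= e.
  rewrite -lee_fin -sumEFin; apply: le_trans (ltW sumU).
  rewrite -(big_mkord predT (fun j => (d j ^+ K)%:E)).
  apply: le_trans (nneseries_lim_ge (P := predT) m _); last by move=> j _ _; apply: diam_pow_ge0.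
  by apply: lee_sum => j _; apply: dK.
have sum_eta : \sum_(j < m) eta j <= e.
  have := half_sums m (ltW e0).
  have -> : iota 0 m = index_iota 0 m by rewrite /index_iota subn0.
  by rewrite big_mkord.
have radK j : rad j ^+ K <= 2 ^+ K * (d j ^+ K + eta j).
  apply: le_trans (exprD_le (d0 j) (ltW (eta0 j))) _.
  rewrite ler_wpM2l ?exprn_ge0 // lerD2l exprS ler_piMr ?(ltW (eta0 j)) //.
  by rewrite exprn_ile1 // ltW.
have : \sum_(j < m) rad j ^+ K <= 2 ^+ K * (2 * e).
  apply: (@le_trans _ _ (\sum_(j < m) 2 ^+ K * (d j ^+ K + eta j))).
    by apply: ler_sum => j _; apply: radK.
  rewrite -mulr_sumr big_split ler_wpM2l ?exprn_ge0 //=; lra.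
have q0 : 0 <= (4 / sg) ^+ K by rewrite exprn_ge0 // divr_ge0 // ltW.
move=> /(ler_wpM2l q0) h1 h2; have := le_trans h2 h1.
have -> : (4 / sg) ^+ K * (2 ^+ K * (2 * e)) = C * e by rewrite /C; ring.
rewrite /e ler_pdivlMr; lra.
Qed.

End HausdorffLowerBound.

(** * A cube in the projection of the exceptional set *)

Section ExceptionalDimension.
Variables (R : realType) (k : nat).
Local Notation K := k.+1.
Local Notation n := (k + K + 1)%N.

Definition slope_breaks (x : 'rV[R]_n) : 'rV[R]_K :=
  \row_j if unlift ord0 j is Some i then pa x 0 i else pl x.

Lemma slope_breaks_lipschitz x y i :
  `|slope_breaks x 0 i - slope_breaks y 0 i| <= euclidean_dist x y.
Proof. by rewrite !mxE; case: unlift => [j|]; rewrite /pa /pl !mxE; apply: coord_le_dist. Qed.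

Lemma AsetP (a : 'rV[R]_k) :
  (forall i, (i < K)%N -> al a i < al a i.+1) -> @Aset R K a.
Proof.
move=> H; apply/(sortedP 0) => i; rewrite size_breakpoints ltnS; exact: H.
Qed.

Lemma exceptional_dim : (K%:R%:E <= hausdorff_dim (@exceptional_set R K))%E.
Proof.
have k3 : 0 < k.+3%:R :> R by rewrite ltr0n.
(* The sides [[lo j, lo j + sg]] are half as long as their spacing and lie inside (0,1). So
   coordinate 0 is a valid slope and the other ones are increasing breakpoints for every point of
   the cube. *)
pose lo (j : 'I_K) : R := j.+1%:R / k.+3%:R.
pose sg : R := 1 / 2 / k.+3%:R.
have sg0 : 0 < sg by rewrite divr_gt0 // divr_gt0.
apply: (hausdorff_dim_ge sg0 (lo := lo) slope_breaks_lipschitz) => t ht.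
have {}ht (j : 'I_K) : j.+1%:R <= t 0 j * k.+3%:R <= j.+1%:R + 1 / 2.
  have /andP[h1 h2] := ht j; move: h1 h2; rewrite /lo /sg -mulrDl.
  by rewrite ler_pdivrMr // ler_pdivlMr // => -> ->.
pose a : 'rV[R]_k := \row_i t 0 (lift ord0 i).
have t_gt0 : 0 < t 0 ord0.
  have /andP[h _] := ht ord0; rewrite -(pmulr_lgt0 _ k3); exact: lt_le_trans h.
have t_lt1 : t 0 ord0 < 1.
  have /andP[_ h] := ht ord0; rewrite -(ltr_pM2r k3) mul1r; apply: le_lt_trans h _.
  have : 3%:R <= k.+3%:R :> R by rewrite ler_nat.
  rewrite /=; lra.
have aA : @Aset R K a.
  apply: AsetP => i iK; rewrite -(ltr_pM2r k3).
  apply: (@le_lt_trans _ _ (i.+1%:R + 1 / 2)).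
    have [i0|i0|[j i0]] := al_case a (ltnW iK).
    - by rewrite i0 al0 mul0r; lra.
    - by rewrite i0 ltnn in iK.
    - by rewrite i0 alS mxE; have /andP[_] := ht (lift ord0 j).
  apply: (@lt_le_trans _ _ i.+2%:R).
    by rewrite -[i.+2%:R]natr1; lra.
  have [//|i0|[j i0]] := al_case a iK.
    by rewrite i0 alK mul1r ler_nat; lia.
  by rewrite i0 alS mxE; have /andP[] := ht (lift ord0 j).
have la01 : 0 < t 0 ord0 < 1 by rewrite t_gt0.
have [b Hb] := equal_intercepts_not_periodic la01.
exists (row_mx (row_mx a (const_mx b)) (const_mx (t 0 ord0))).
  by exists (a, const_mx b, t 0 ord0) => //; split=> //; apply: Hb.
apply/rowP => j; rewrite mxE /pa /pl !row_mxKl !row_mxKr.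
by case: unliftP => [i ->|->]; rewrite mxE.
Qed.

End ExceptionalDimension.

Theorem corollary6 (R : realType) (k : nat) (hk : (0 < k)%N) :
  lebesgue_outer (@exceptional_set R k) = 0%E /\
  (k%:R%:E <= hausdorff_dim (@exceptional_set R k))%E.
Proof.
case: k hk => // k _; split; last exact: exceptional_dim.
exact/null_lebesgue_outer/exceptional_null.
Qed.
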